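(* Let $\Gamma$ be a Coxeter graph and identify $W[\Gamma]$ with its image under the embedding $\iota_W:W[\Gamma]\hookrightarrow VA[\Gamma]$. Then the centralizer of $W[\Gamma]$ in $VA[\Gamma]$ equals the center $Z(W[\Gamma])$ of $W[\Gamma]$.
   Context: A Coxeter matrix on a countable set $S$ is a symmetric matrix $M=(m_{s,t})_{s,t\in S}$ with entries in $\mathbb{N}\cup\{\infty\}$ such that $m_{s,s}=1$ for all $s$ and $m_{s,t}=m_{t,s}\ge 2$ for $s\neq t$; it is encoded by a Coxeter graph $\Gamma$ with vertex set $S$. For letters $a,b$ and an integer $m\ge 2$, $\Pi_R(b,a,m)$ denotes the alternating word $\cdots aba$ of length $m$ ending with $a$; the same notation denotes the element it represents in a group. The Coxeter group $W[\Gamma]$ is $\langle S\mid s^2=1,\ \Pi_R(t,s,m_{s,t})=\Pi_R(s,t,m_{s,t})\text{ for } s\neq t,\ m_{s,t}\neq\infty\rangle$. The virtual Artin group $VA[\Gamma]$ is the group generated by two sets $\{\sigma_s\mid s\in S\}$ and $\{\tau_s\mid s\in S\}$ in bijection with $S$, subject to the following relations, for all $s,t\in S$ with $s\neq t$ and $m_{s,t}\neq\infty$: (v1) $\Pi_R(\sigma_t,\sigma_s,m_{s,t})=\Pi_R(\sigma_s,\sigma_t,m_{s,t})$; (v2) $\Pi_R(\tau_t,\tau_s,m_{s,t})=\Pi_R(\tau_s,\tau_t,m_{s,t})$, together with $\tau_s^2=1$ for all $s\in S$; (v3) $\Pi_R(\tau_s,\tau_t,m_{s,t}-1)\,\sigma_s=\sigma_r\,\Pi_R(\tau_s,\tau_t,m_{s,t}-1)$,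 where $r=s$ if $m_{s,t}$ is even and $r=t$ if $m_{s,t}$ is odd. The homomorphism $\iota_W:W[\Gamma]\to VA[\Gamma]$ is $s\mapsto\tau_s$ (it is injective). *)

(* Defs.v *)
(* Groups given by presentations are modelled
   as words in generators and their inverses, modulo the congruence
   generated by the relators. *)
From mathcomp Require Import all_boot.
Set Implicit Arguments. Unset Strict Implicit. Unset Printing Implicit Defensive.

(* Words over letters L: a letter with a flag (false = x, true = x^-1). *)
Definition pos_word {L : Type} (u : seq L) : seq (L * bool) :=
  [seq (x, false) | x <- u].

Inductive pres_eq {L : Type} (R : seq L -> seq L -> Prop) :
    seq (L * bool) -> seq (L * bool) -> Prop :=
| pe_refl u : pres_eq R u u
| pe_sym u v : pres_eq R u v -> pres_eq R v u
| pe_trans u v w : pres_eq R u v -> pres_eq R v w -> pres_eq R u w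
| pe_ctx p q u v : pres_eq R u v -> pres_eq R (p ++ u ++ q) (p ++ v ++ q)
| pe_free x b : pres_eq R [:: (x, b); (x, ~~ b)] [::]
| pe_rel u v : R u v -> pres_eq R (pos_word u) (pos_word v).

(* Pi_R(b, a, m): alternating word ... a b a of length m ending with a. *)
Fixpoint alt {L : Type} (b a : L) (m : nat) : seq L :=
  match m with
  | 0 => [::]
  | m'.+1 => rcons (alt a b m') a
  end.

(* Coxeter matrix on S; None encodes infinity. *)
Definition is_coxeter_matrix (S : countType) (m : S -> S -> option nat) : Prop :=
  (forall s, m s s = Some 1%N) /\
  (forall s t, m s t = m t s) /\
  (forall s t k, s <> t -> m s t = Some k -> (2 <= k)%N).

Definition cox_rel (S : countType) (m : S -> S -> option nat)
    (u v : seq S) : Prop :=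
  (exists s, u = [:: s; s] /\ v = [::]) \/
  (exists s t k, s <> t /\ m s t = Some k /\ u = alt t s k /\ v = alt s t k).

Definition W_eq (S : countType) (m : S -> S -> option nat) :=
  pres_eq (cox_rel m).

Inductive va_letter (S : Type) : Type :=
| sigma of S
| tau of S.

Definition va_rel (S : countType) (m : S -> S -> option nat)
    (u v : seq (va_letter S)) : Prop :=
  (exists s t k, s <> t /\ m s t = Some k /\
     u = alt (sigma t) (sigma s) k /\ v = alt (sigma s) (sigma t) k) \/
  (exists s t k, s <> t /\ m s t = Some k /\
     u = alt (tau t) (tau s) k /\ v = alt (tau s) (tau t) k) \/
  (exists s, u = [:: tau s; tau s] /\ v = [::]) \/
  (exists s t k, s <> t /\ m s t = Some k /\
     u = alt (tau s) (tau t) k.-1 ++ [:: sigma s] /\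
     v = sigma (if odd k then t else s) :: alt (tau s) (tau t) k.-1).

Definition VA_eq (S : countType) (m : S -> S -> option nat) :=
  pres_eq (va_rel m).

Definition iota_W (S : Type) (w : seq (S * bool)) : seq (va_letter S * bool) :=
  [seq (tau p.1, p.2) | p <- w].

(* Main.v *)
(* VA is the semidirect product of the kernel K of [sigma_s |-> 1, tau_s |-> s]
   and W, and K is an Artin group A whose generators are permuted by W like
   roots; an element of the centralizer of W is [k z] with [z] central in W and
   [k] in K fixed by W, so it suffices to show that [k = 1].  For a root [p] with
   reflection r, the generators [p] and [r p = - p] satisfy no relation, so A is
   an amalgam of the subgroups avoiding [p] and [- p], which [r] exchanges: [r]
   reverses an edge of the Bass-Serre tree, and as [k] is fixed by [r] it fixes
   that edge, i.e. [k] lies in the subgroup avoiding both [p] and [- p].  Since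
   standard parabolic subgroups of Artin groups intersect as expected, removing
   in this way every letter of a word for [k] leaves [k = 1]. *)
Require Import Defs.
From HB Require Import structures.
From mathcomp Require Import all_boot all_order all_algebra all_field.
From mathcomp Require Import boolp zify ring.
Set Implicit Arguments. Unset Strict Implicit. Unset Printing Implicit Defensive.
Import GRing.Theory Num.Theory.
Local Open Scope group_scope.

(** * Presented groups *)

(** Group elements are studied through states updated letter by letter: if the update undoes
    cancelling pairs and agrees on both sides of every relator, the final state depends only on the
    element. Inversions in W, the dual geometric representation, the retraction of an Artin group
    onto a parabolic subgroup, the count of edge crossings and the passage from VA to A and W all
    have this form. Hence neither the amalgam nor its tree is built: the reversal of an edge becomes
    a parity argument on an integer count. Nor is the semidirect decomposition established as an
    isomorphism: reading a word yields its part in A, and a homomorphism from A to VA recovers the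
    element from that part. No relation links [p] and [- p] because related roots have the form
    [w alpha_s], [w alpha_t] with [s <> t], so their reflections differ, whereas opposite roots
    share theirs. The geometric representation supplies what the presentation hides: generators are
    distinct in W, [m s t] is the exact order of a product of two of them, and a root differs from
    its opposite. *)

Section PresentedGroup.
Variables (L : Type) (R : seq L -> seq L -> Prop).

(** Elements are whole equivalence classes, as predicates on words, so that equality in the group is
    plain equality and the [groupType] library applies. *)
Record pgroup : Type := PGroup {
  pset : seq (L * bool) -> Prop;
  psetP : exists u, pset = pres_eq R u }.
HB.instance Definition _ := gen_eqMixin pgroup.
HB.instance Definition _ := gen_choiceMixin pgroup.

Definition pclass u : pgroup := PGroup (ex_intro _ u erefl).
Definition prepr (x : pgroup) : seq (L * bool) := sval (cid (psetP x)).

Lemma pset_inj : injective pset.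
Proof.
move=> [C hC] [D hD] /= CD; rewrite -{}CD in hD *.
by rewrite (Prop_irrelevance hC hD).
Qed.

Lemma prepr_class x : pclass (prepr x) = x.
Proof. by apply: pset_inj; rewrite [RHS](svalP (cid (psetP x))). Qed.

Lemma pclass_eq u v : pclass u = pclass v <-> pres_eq R u v.
Proof.
split=> [/(congr1 pset) /= e|uv]; first by rewrite e; exact: pe_refl.
apply/pset_inj/funext => w; apply/propext; split.
  exact: (pe_trans (pe_sym uv)).
exact: pe_trans.
Qed.

Lemma pres_eq_cat u u' v v' :
  pres_eq R u u' -> pres_eq R v v' -> pres_eq R (u ++ v) (u' ++ v').
Proof.
move=> uu' vv'; apply: (@pe_trans _ _ _ (u' ++ v)).
  exact: (@pe_ctx _ _ [::] v).
by have := @pe_ctx _ R u' [::] _ _ vv'; rewrite !cats0.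
Qed.

Definition wordV (u : seq (L * bool)) := rev [seq (l.1, ~~ l.2) | l <- u].

Lemma pres_eq_mulV u : pres_eq R (u ++ wordV u) [::].
Proof.
elim: u => [|[l b] u IH]; first exact: pe_refl.
rewrite /wordV /= rev_cons -cats1 -cat_cons catA -/(wordV u).
have := @pe_ctx _ R [:: (l, b)] [:: (l, ~~ b)] _ _ IH.
by rewrite /= -catA => /pe_trans; apply; exact: pe_free.
Qed.

Lemma wordVK : involutive wordV.
Proof.
move=> u; rewrite /wordV map_rev revK -map_comp -[RHS]map_id.
by apply: eq_map => -[l b] /=; rewrite negbK.
Qed.

Definition pmul x y := pclass (prepr x ++ prepr y).
Definition pinv x := pclass (wordV (prepr x)).

Lemma pclass_mul u v : pclass (u ++ v) = pmul (pclass u) (pclass v).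
Proof. by apply/pclass_eq/pres_eq_cat; apply/pclass_eq; rewrite prepr_class. Qed.

Lemma pmulA : associative pmul.
Proof.
move=> x y z; rewrite -(prepr_class x) -(prepr_class y) -(prepr_class z).
by rewrite -!pclass_mul catA.
Qed.

Lemma pmul1 : left_id (pclass [::]) pmul.
Proof. by move=> x; rewrite -(prepr_class x) -pclass_mul. Qed.

Lemma pmulr1 : right_id (pclass [::]) pmul.
Proof. by move=> x; rewrite -(prepr_class x) -pclass_mul cats0. Qed.

Lemma pmulV : right_inverse (pclass [::]) pinv pmul.
Proof.
move=> x; rewrite -{1}(prepr_class x) -pclass_mul; apply/pclass_eq.
exact: pres_eq_mulV.
Qed.

Lemma pVmul : left_inverse (pclass [::]) pinv pmul.
Proof.
move=> x; rewrite -{2}(prepr_class x) -pclass_mul; apply/pclass_eq.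
by have := pres_eq_mulV (wordV (prepr x)); rewrite wordVK.
Qed.

HB.instance Definition _ := isGroup.Build pgroup pmulA pmul1 pmulr1 pVmul pmulV.

Definition pgen l : pgroup := pclass [:: (l, false)].

End PresentedGroup.

Section Evaluation.
Variables (L : Type) (G : groupType).

Definition weval (f : L -> G) (u : seq (L * bool)) : G :=
  \prod_(l <- u) (if l.2 then (f l.1)^-1 else f l.1).
Definition peval (f : L -> G) (u : seq L) : G := \prod_(l <- u) f l.

Lemma weval_cat f u v : weval f (u ++ v) = weval f u * weval f v.
Proof. exact: big_cat. Qed.

Lemma weval_nil f : weval f [::] = 1.
Proof. exact: big_nil. Qed.

Lemma weval_cons f l u :
  weval f (l :: u) = (if l.2 then (f l.1)^-1 else f l.1) * weval f u.
Proof. exact: big_cons. Qed.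

Lemma weval1 f l : weval f [:: l] = if l.2 then (f l.1)^-1 else f l.1.
Proof. exact: big_seq1. Qed.

Lemma weval_pos f u : weval f (pos_word u) = peval f u.
Proof. by rewrite /weval big_map. Qed.

Lemma peval_cat f u v : peval f (u ++ v) = peval f u * peval f v.
Proof. exact: big_cat. Qed.

Lemma peval_cons f x u : peval f (x :: u) = f x * peval f u.
Proof. exact: big_cons. Qed.

Lemma peval_nil f : peval f [::] = 1.
Proof. exact: big_nil. Qed.

Lemma peval_rcons f x u : peval f (rcons u x) = peval f u * f x.
Proof. by rewrite -cats1 peval_cat peval_cons peval_nil mulg1. Qed.

Lemma weval_wordV f u : weval f (wordV u) = (weval f u)^-1.
Proof.
elim: u => [|[l b] u IH]; first by rewrite weval_nil invg1.
rewrite /wordV /= rev_cons -cats1 weval_cat -/(wordV u) IH weval1 weval_cons.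
by rewrite invgM; case: b; rewrite /= ?invgK.
Qed.

Definition respects (R : seq L -> seq L -> Prop) (f : L -> G) :=
  forall u v, R u v -> peval f u = peval f v.

Lemma weval_pres_eq R f u v : respects R f -> pres_eq R u v ->
  weval f u = weval f v.
Proof.
move=> fR; elim=> {u v} // [u v w _ -> _ -> //|p q u v _ IH|x b|u v uv].
- by rewrite !weval_cat IH.
- by rewrite weval_cons weval1 weval_nil; case: b; rewrite /= ?mulVg ?mulgV.
- by rewrite !weval_pos; exact: fR.
Qed.

Definition plift R (f : L -> G) (x : pgroup R) : G := weval f (prepr x).

End Evaluation.

Section PresentedGroupTheory.
Variables (L : Type) (R : seq L -> seq L -> Prop).

Lemma pgenV l : (pgen R l)^-1 = pclass R [:: (l, true)].
Proof. by apply: mulg1_eq; rewrite /pgen -[LHS]pclass_mul; apply/pclass_eq/pe_free. Qed.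

Lemma weval_pgen u : weval (pgen R) u = pclass R u.
Proof.
elim: u => [|[l b] u IH]; first by rewrite weval_nil.
rewrite weval_cons IH -cat1s pclass_mul; case: b => //=.
by rewrite pgenV.
Qed.

Lemma weval_prepr (x : pgroup R) : weval (pgen R) (prepr x) = x.
Proof. by rewrite weval_pgen prepr_class. Qed.

Lemma weval_eqP u v : weval (pgen R) u = weval (pgen R) v <-> pres_eq R u v.
Proof. by rewrite !weval_pgen; exact: pclass_eq. Qed.

Lemma respects_pgen : respects R (pgen R).
Proof. by move=> u v uv; rewrite -!weval_pos; apply/weval_eqP/pe_rel. Qed.

Section Lift.
Variables (G : groupType) (f : L -> G).
Hypothesis fR : respects R f.

Lemma plift_weval u : plift f (weval (pgen R) u) = weval f u.
Proof. by apply: weval_pres_eq fR _; apply/weval_eqP; rewrite weval_prepr. Qed.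

Lemma pliftM : {morph plift (R := R) f : x y / x * y}.
Proof.
move=> x y; rewrite -(weval_prepr x) -(weval_prepr y) -weval_cat.
by rewrite !plift_weval weval_cat.
Qed.

Lemma plift1 : plift f (1 : pgroup R) = 1.
Proof. by rewrite -(weval_nil (pgen R)) plift_weval weval_nil. Qed.

Lemma pliftV : {morph plift (R := R) f : x / x^-1}.
Proof. by move=> x; apply/esym/mulg1_eq; rewrite -pliftM mulgV plift1. Qed.

Lemma plift_gen l : plift f (pgen R l) = f l.
Proof. by rewrite -[pgen R l](weval1 (pgen R) (l, false)) plift_weval weval1. Qed.

End Lift.

Lemma foldl_pos_word (X : Type) (act : X -> L * bool -> X) x u :
  foldl act x (pos_word u) = foldl (fun x l => act x (l, false)) x u.
Proof. by elim: u x => //= l u IH x. Qed.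

(** The invariant [I] is there for the retraction, whose update is consistent only on minimal coset
    representatives; the other actions take it trivial. *)
Lemma foldl_pres_eq (X : Type) (act : X -> L * bool -> X) (I : X -> Prop) :
  (forall x l, I x -> I (act x l)) ->
  (forall x l b, I x -> act (act x (l, b)) (l, ~~ b) = x) ->
  (forall u v x, R u v -> I x ->
     foldl (fun x l => act x (l, false)) x u =
     foldl (fun x l => act x (l, false)) x v) ->
  forall u v, pres_eq R u v -> forall x, I x -> foldl act x u = foldl act x v.
Proof.
move=> Iact actK actR u v.
have If w x : I x -> I (foldl act x w).
  by elim: w x => //= l w IH x /(Iact _ l); exact: IH.
elim=> {u v} //= [u v _ IH x|u v w _ IH1 _ IH2 x|p q u v _ IH x|l b x|u v uv x] Ix.
- by rewrite IH.
- by rewrite IH1 ?IH2.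
- by rewrite !foldl_cat IH //; exact: If.
- exact: actK.
- by rewrite !foldl_pos_word; exact: actR.
Qed.

End PresentedGroupTheory.

(** * Coxeter groups *)

(** Restated over any type of generators: the Artin group in the kernel is generated by the type
    [root], which carries no [countType] structure. *)
Definition coxeter_matrix (S : Type) (m : S -> S -> option nat) : Prop :=
  [/\ forall s, m s s = Some 1%N, forall s t, m s t = m t s &
      forall s t k, s <> t -> m s t = Some k -> (2 <= k)%N].

Definition artin_rel (S : Type) (m : S -> S -> option nat) (u v : seq S) :=
  exists s t k, s <> t /\ m s t = Some k /\ u = alt t s k /\ v = alt s t k.

Definition coxeter_rel (S : Type) (m : S -> S -> option nat) (u v : seq S) :=
  (exists s, u = [:: s; s] /\ v = [::]) \/ artin_rel m u v.

(** [alt] prescribes the last letter, [zig] the first, which suits left folds. Exchanging the two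
    letters swaps the sides of a braid relation, so both forms give the same relations. *)
Fixpoint zig (T : Type) (a b : T) n :=
  if n is n'.+1 then a :: zig b a n' else [::].

Section Zig.
Variable T : Type.

Lemma zigSr (a b : T) n : zig a b n.+1 = rcons (zig a b n) (if odd n then b else a).
Proof. by elim: n a b => //= n IH a b; rewrite {1}/zig -/zig IH /=; case: odd. Qed.

Lemma alt_zig (a b : T) n : alt b a n = if odd n then zig a b n else zig b a n.
Proof.
elim: n a b => [//|n IH] a b; rewrite -[alt _ _ _]/(rcons (alt a b n) a) IH.
by rewrite !zigSr /=; case: odd.
Qed.

Lemma zig_rel (U : Type) (f : seq T -> U) a b n :
  f (zig a b n) = f (zig b a n) -> f (alt b a n) = f (alt a b n).
Proof. by rewrite !alt_zig; case: odd. Qed.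

Lemma alt_rel (U : Type) (f : seq T -> U) a b n :
  f (alt b a n) = f (alt a b n) -> f (zig a b n) = f (zig b a n).
Proof. by rewrite !alt_zig; case: odd. Qed.

End Zig.

(** * Dihedral identities for two involutions *)

Section Dihedral.
Variables (G : groupType) (L : Type) (f : L -> G).

Hypothesis ff1 : forall l, f l * f l = 1.

Lemma invol_V l : (f l)^-1 = f l.
Proof. exact: mulg1_eq. Qed.

Lemma expg_swap a b n : f a * (f b * f a) ^+ n = (f a * f b) ^+ n * f a.
Proof.
elim: n => [|n IH]; first by rewrite mulg1 mul1g.
by rewrite expgSr mulgA IH expgSr !mulgA.
Qed.

(** Conjugating the next letter by the prefix read so far gives the [n]-th reflection of the
    dihedral group. *)
Lemma zig_reflection a b n :
  peval f (zig a b n) * f (if odd n then b else a) =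
  (f a * f b) ^+ n * f a * peval f (zig a b n).
Proof.
elim: n a b => [|n IH] a b; first by rewrite peval_nil !mulg1 mul1g.
rewrite /= !peval_cons -mulgA -[if ~~ _ then _ else _]/(if ~~ odd n then b else a).
have -> : (if ~~ odd n then b else a) = if odd n then a else b by case: odd.
rewrite IH [RHS]mulgA -[_ * f a * f a]mulgA ff1 mulg1 expgSr.
by rewrite !mulgA expg_swap.
Qed.

Lemma zig_div a b n :
  peval f (zig a b n) / peval f (zig b a n) = (f a * f b) ^+ n.
Proof.
elim: n a b => [|n IH] a b; first by rewrite peval_nil divg1.
rewrite /= !peval_cons invgM -mulgA [peval _ _ * _]mulgA IH invol_V.
by rewrite mulgA expg_swap expgSr !mulgA.
Qed.

Lemma zig_eq_expg a b n : (f a * f b) ^+ n = 1 <->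
  peval f (zig a b n) = peval f (zig b a n).
Proof.
rewrite -zig_div; split=> [/divg1_eq //|->]; exact: mulgV.
Qed.

(** The two sides of a braid relation meet the same reflections, in opposite orders. *)
Lemma reflection_rev a b n i : (f a * f b) ^+ n = 1 -> i < n ->
  (f b * f a) ^+ i * f b = (f a * f b) ^+ (n - i.+1) * f a.
Proof.
move=> abn lt_in.
have V : (f a * f b)^-1 = f b * f a by rewrite invgM !invol_V.
apply: (mulgI ((f a * f b) ^+ i.+1)); rewrite !mulgA.
rewrite -[in RHS]expgnDr subnKC // abn mul1g -V expVgn expgS.
by rewrite mulgK -mulgA ff1 mulg1.
Qed.

End Dihedral.

Section CoxeterGroup.
Variables (S : Type) (m : S -> S -> option nat).
Notation W := (pgroup (coxeter_rel m)).
Notation gen := (pgen (coxeter_rel m)).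
Implicit Types (w : W) (X : pred S).

Lemma gen_sq s : gen s * gen s = 1.
Proof.
have := @respects_pgen _ (coxeter_rel m) [:: s; s] [::].
rewrite !peval_cons peval_nil mulg1; apply.
by left; exists s.
Qed.

Lemma gen_inv s : (gen s)^-1 = gen s.
Proof. exact: mulg1_eq (gen_sq s). Qed.

Lemma gen_zig s t k : s <> t -> m s t = Some k ->
  peval gen (zig s t k) = peval gen (zig t s k).
Proof.
move=> st mst; apply: alt_rel; apply: respects_pgen.
by right; exists s, t, k.
Qed.

Lemma gen_braid s t k : s <> t -> m s t = Some k -> (gen s * gen t) ^+ k = 1.
Proof. by move=> st mst; apply/(zig_eq_expg gen_sq)/gen_zig. Qed.

Lemma coxeter_foldl (A : Type) (act : A -> S -> A) (I : A -> Prop) :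
  (forall a s, I a -> I (act a s)) ->
  (forall a s, I a -> act (act a s) s = a) ->
  (forall a s t k, I a -> s <> t -> m s t = Some k ->
     foldl act a (zig s t k) = foldl act a (zig t s k)) ->
  forall u v, pres_eq (coxeter_rel m) u v ->
  forall a, I a -> foldl (fun a l => act a l.1) a u = foldl (fun a l => act a l.1) a v.
Proof.
move=> Iact actK actz; apply: foldl_pres_eq.
- by move=> a l; exact: Iact.
- by move=> a s b; exact: actK.
move=> u v a [[s [-> ->]]|[s [t [k [st [mst [-> ->]]]]]]] Ia /=; first exact: actK.
exact: (zig_rel (f := foldl act a) (actz _ _ _ _ Ia st mst)).
Qed.

Lemma weval_fst (u : seq (S * bool)) : weval gen u = peval gen [seq l.1 | l <- u].
Proof.
elim: u => [|[s b] u IH]; first by rewrite weval_nil peval_nil.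
by rewrite weval_cons peval_cons IH; case: b; rewrite //= gen_inv.
Qed.

Lemma coxeter_word w : exists u, peval gen u = w.
Proof. by exists [seq l.1 | l <- prepr w]; rewrite -weval_fst weval_prepr. Qed.

(* The action of W on signed reflections, extended to W * bool. *)
Definition sign_act (a : W * bool) (s : S) : W * bool :=
  (a.1 ^ gen s, a.2 (+) (a.1 == gen s)).

Lemma sign_act_foldl (a : W * bool) u : foldl sign_act a u =
  (a.1 ^ peval gen u, a.2 (+) (foldl sign_act (a.1, false) u).2).
Proof.
elim: u a => [|s u IH] [t e]; first by rewrite peval_nil /= conjg1 addbF.
rewrite /= IH [in RHS]IH /sign_act /= peval_cons conjgM.
by rewrite addbA.
Qed.

Lemma sign_zig t s s' n : (foldl sign_act (t, false) (zig s s' n)).2 =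
  odd (\sum_(i < n) (t == (gen s * gen s') ^+ i * gen s)%g)%N.
Proof.
elim: n => [|n IH]; first by rewrite big_ord0.
rewrite zigSr foldl_rcons sign_act_foldl big_ord_recr oddD -IH /= oddb; congr (_ (+) _).
have := zig_reflection gen_sq s s' n; set g := peval _ _; set p := _ * gen s => gl.
by rewrite conjgE -(inj_eq (mulgI g)) gl mulVKg (inj_eq (mulIg g)).
Qed.

(** The predicate is arbitrary because it serves twice: equality with a given reflection, for signs,
    and conjugacy into a parabolic subgroup, for the retraction. *)
Lemma sum_reflection_rev (P : pred W) s t k : s <> t -> m s t = Some k ->
  (\sum_(i < k) P ((gen s * gen t) ^+ i * gen s)%g =
   \sum_(i < k) P ((gen t * gen s) ^+ i * gen t)%g)%N.
Proof.
move=> st mst; rewrite (reindex_inj rev_ord_inj); apply: eq_bigr => i _ /=.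
by rewrite -(reflection_rev gen_sq (gen_braid st mst)).
Qed.

End CoxeterGroup.

(** * Inversions, the exchange condition and word length *)

Section Length.
Variables (S : Type) (m : S -> S -> option nat).
Notation W := (pgroup (coxeter_rel m)).
Notation gen := (pgen (coxeter_rel m)).
Implicit Types (w : W) (X : pred S).

Lemma coxeter_word_foldl (A : Type) (act : A -> S -> A) (I : A -> Prop) :
  (forall a s, I a -> I (act a s)) ->
  (forall a s, I a -> act (act a s) s = a) ->
  (forall a s t k, I a -> s <> t -> m s t = Some k ->
     foldl act a (zig s t k) = foldl act a (zig t s k)) ->
  forall u v, peval gen u = peval gen v -> forall a, I a -> foldl act a u = foldl act a v.
Proof.
move=> Iact actK actz u v uv a Ia.
have /(coxeter_foldl Iact actK actz)/(_ a Ia) : pres_eq (coxeter_rel m) (pos_word u) (pos_word v).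
  by apply/weval_eqP; rewrite !weval_pos.
by rewrite !(foldl_pos_word (fun a (l : S * bool) => act a l.1)).
Qed.

(** The parity with which [t] occurs among the reflections met along a word for [w]: for a
    reflection, left inversion. *)
Definition inversion w t : bool :=
  (foldl (@sign_act S m) (t, false) [seq l.1 | l <- prepr w]).2.

Lemma inversion_word u t :
  inversion (peval gen u) t = (foldl (@sign_act S m) (t, false) u).2.
Proof.
congr (_.2); apply: (coxeter_word_foldl (I := fun=> True)) => // {t}.
- move=> [t e] s _; rewrite /sign_act /= -conjgM gen_sq conjg1; congr (_, _).
  have ss : gen s ^ gen s = gen s by rewrite conjgE mulKg.
  by have := inj_eq (@conjg_inj _ (gen s)) t (gen s); rewrite /= ss => ->; rewrite addbK.
- move=> [t e] s s' k _ ss' mss'; rewrite sign_act_foldl [RHS]sign_act_foldl.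
  rewrite (gen_zig ss' mss') !sign_zig /=.
  by rewrite (sum_reflection_rev (fun x => t == x) ss' mss').
- by rewrite -weval_fst weval_prepr.
Qed.

Lemma inversionM v w t : inversion (v * w) t = inversion v t (+) inversion w (t ^ v).
Proof.
have [u <-] := coxeter_word v; have [u' <-] := coxeter_word w.
rewrite -peval_cat !inversion_word foldl_cat sign_act_foldl /=.
by rewrite [X in X.1]sign_act_foldl.
Qed.

Lemma inversion_gen s t : inversion (gen s) t = (t == gen s).
Proof.
have -> : gen s = peval gen [:: s] by rewrite peval_cons peval_nil mulg1.
by rewrite inversion_word /= peval_cons peval_nil mulg1.
Qed.

Lemma inversion1 t : inversion 1 t = false.
Proof. by rewrite -(peval_nil gen) inversion_word. Qed.

(** By the cocycle rule [inversionM], an inverted [t] either is the first letter, which is then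
    deleted, or its conjugate by that letter is inverted by the rest. *)
Lemma exchange u t : inversion (peval gen u) t ->
  exists u1 y u2, u = u1 ++ y :: u2 /\ t * peval gen u = peval gen (u1 ++ u2).
Proof.
elim: u t => [|s u IH] t; first by rewrite peval_nil inversion1.
rewrite peval_cons inversionM inversion_gen; have [-> _|_ /=] := eqVneq.
  by exists [::], s, u; rewrite mulgA gen_sq mul1g.
case/IH=> u1 [y [u2 [-> e]]]; exists (s :: u1), y, u2; split=> //=.
by rewrite peval_cons -e conjgE !mulgA mulgV mul1g.
Qed.

Lemma length_subproof w : exists n, `[< exists2 u, size u = n & peval gen u = w >].
Proof. by have [u uw] := coxeter_word w; exists (size u); apply/asboolP; exists u. Qed.

Definition len w := ex_minn (length_subproof w).

Lemma len_word w : exists2 u, size u = len w & peval gen u = w.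
Proof. by rewrite /len; case: ex_minnP => n /asboolP. Qed.

Lemma len_le u : len (peval gen u) <= size u.
Proof. by rewrite /len; case: ex_minnP => n _; apply; apply/asboolP; exists u. Qed.

Lemma len1 : len 1 = 0%N.
Proof. by apply/eqP; rewrite -leqn0 -(peval_nil gen) len_le. Qed.

Lemma len_eq0 w : len w = 0%N -> w = 1.
Proof. by move=> w0; have [[|s u]] := len_word w; rewrite w0 // => _ <-; exact: peval_nil. Qed.

Lemma len_gen s : len (gen s) <= 1.
Proof. by have := len_le [:: s]; rewrite peval_cons peval_nil mulg1. Qed.

Lemma lenM v w : len (v * w) <= len v + len w.
Proof.
have [u <- <-] := len_word v; have [u' <- <-] := len_word w.
by rewrite -peval_cat -size_cat len_le.
Qed.

Lemma lenV w : len w^-1 = len w.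
Proof.
suff le v : len v^-1 <= len v by apply/eqP; rewrite eqn_leq le -{1}(invgK w) le.
have [u <- <-] := len_word v.
have -> : (peval gen u)^-1 = peval gen (rev u); last by rewrite -size_rev len_le.
elim: u => [|s u IH]; first by rewrite peval_nil invg1.
by rewrite rev_cons peval_rcons peval_cons invgM IH gen_inv.
Qed.

Lemma inversion_len w s : inversion w (gen s) -> len (gen s * w) < len w.
Proof.
have [u <- <-] := len_word w => /exchange[u1 [y [u2 [-> ->]]]].
by apply: leq_ltn_trans (len_le _) _; rewrite !size_cat /=; lia.
Qed.

(** Multiplying by [gen s] flips whether [gen s] is inverted, so the shortening lemma applies to
    [gen s * w]. *)
Lemma not_inversion_len w s : ~~ inversion w (gen s) -> len w < len (gen s * w).
Proof.
move=> nw; rewrite -{1}[w](mulKg (gen s)) gen_inv; apply: inversion_len.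
by rewrite inversionM inversion_gen eqxx conjgE mulKg.
Qed.

End Length.

Section Span.
Variables (L : Type) (R : seq L -> seq L -> Prop).
Implicit Types (X Y : pred L).

Definition gspan X (g : pgroup R) :=
  exists2 u, all (fun l => X l.1) u & weval (pgen R) u = g.

Lemma gspan1 X : gspan X 1.
Proof. by exists [::]; rewrite ?weval_nil. Qed.

Lemma gspan_gen X l : X l -> gspan X (pgen R l).
Proof. by move=> Xl; exists [:: (l, false)]; rewrite /= ?Xl ?weval1. Qed.

Lemma gspanM X g h : gspan X g -> gspan X h -> gspan X (g * h).
Proof.
by move=> [u Xu <-] [v Xv <-]; exists (u ++ v); rewrite ?all_cat ?Xu ?weval_cat.
Qed.

Lemma gspanV X g : gspan X g -> gspan X g^-1.
Proof.
move=> [u Xu <-]; exists (wordV u); last exact: weval_wordV.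
by rewrite all_rev all_map.
Qed.

End Span.
Arguments gspan_gen {L R X l} _.
Arguments gspan1 {L R X}.

(** * Parabolic subgroups and minimal coset representatives *)

Section Parabolic.
Variables (S : Type) (m : S -> S -> option nat).
Notation W := (pgroup (coxeter_rel m)).
Notation gen := (pgen (coxeter_rel m)).
Implicit Types (w v : W) (X : pred S).

Lemma gspan_word X w : gspan X w <-> exists2 u, all X u & peval gen u = w.
Proof.
split=> [[u Xu <-]|[u Xu <-]].
  by exists [seq l.1 | l <- u]; rewrite ?weval_fst // all_map.
by exists (pos_word u); rewrite ?weval_pos // all_map.
Qed.

Definition minimal X w := forall x, X x -> ~~ inversion w (gen x).

(** If a letter [x] failed to lengthen the product, the exchange condition would delete either a
    letter of [r], against its minimality, or a letter of [w]; in the latter case a conjugate of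
    [x], still in the parabolic subgroup, would shorten [w]. Minimality of [r] is only among words
    in [X], so [w = 1] shows that such words are reduced in W. *)
Lemma strongly_minimal_len X w r :
  (forall v, gspan X v -> len w <= len (v * w)) -> all X r ->
  (forall r', all X r' -> peval gen r' = peval gen r -> size r <= size r') ->
  len (peval gen r * w) = (size r + len w)%N.
Proof.
move=> minw; elim: r => [|x r IH] /=; first by rewrite peval_nil mul1g.
case/andP=> Xx Xr minr.
have {}IH : len (peval gen r * w) = (size r + len w)%N.
  apply: IH => // r' Xr' er'; apply: (minr (x :: r')); first by rewrite /= Xx.
  by rewrite !peval_cons er'.
rewrite peval_cons -mulgA; apply/eqP; rewrite eqn_leq addSn -IH.
apply/andP; split.
  by apply: leq_trans (lenM _ _) _; rewrite -add1n leq_add2r len_gen.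
apply/not_inversion_len/negP.
have [q lq qw] := len_word w; rewrite inversionM; case: (boolP (inversion _ _)) => [|_ /=].
  case/exchange=> u1 [y [u2 [er eu]]] _.
  have := minr (u1 ++ u2); rewrite -eu peval_cons er !size_cat /=.
  have: all X (u1 ++ u2) by move: Xr; rewrite er !all_cat /= => /and3P[-> _ ->].
  by move=> -> /(_ isT erefl); lia.
rewrite -{1}qw => /exchange[u1 [y [u2 [eq eu]]]].
have /minw : gspan X (gen x ^ peval gen r).
  rewrite conjgE; have Xpr : gspan X (peval gen r) by apply/gspan_word; exists r.
  by apply: gspanM (gspanV Xpr) (gspanM (gspan_gen Xx) Xpr).
rewrite -qw eu qw -lq eq => /leq_trans/(_ (len_le _ _)).
by rewrite !size_cat /=; lia.
Qed.

Lemma minimal_word X v : gspan X v -> exists r, [/\ all X r, peval gen r = v &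
  forall r', all X r' -> peval gen r' = peval gen r -> size r <= size r'].
Proof.
move=> /gspan_word[u0 Xu0 u0v].
have: exists n, `[< exists u, [/\ all X u, peval gen u = v & size u = n] >].
  by exists (size u0); apply/asboolP; exists u0.
case/ex_minnP=> n /asboolP[r [Xr rv rn]] minn; exists r; split=> // r' Xr' r'v.
by rewrite rn; apply: minn; apply/asboolP; exists r'; rewrite r'v.
Qed.

Lemma gspan_len X v : gspan X v -> exists r, [/\ all X r, peval gen r = v & size r = len v].
Proof.
case/minimal_word=> r [Xr rv minr]; exists r; split=> //.
have := @strongly_minimal_len X 1 r; rewrite mulg1 len1 addn0 rv => -> //.
by rewrite -rv.
Qed.

(** Lengths add over the shortest element [v0 * w] of the coset. If [v0] were nontrivial, the first
    letter of a reduced word for its inverse would be a left descent of [w] in [X]. *)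
Lemma minimal_len X w v : minimal X w -> gspan X v -> len (v * w) = (len v + len w)%N.
Proof.
have: exists n, `[< exists v, gspan X v /\ len (v * w) = n >].
  by exists (len w); apply/asboolP; exists 1; rewrite mul1g; split=> //; exact: gspan1.
case/ex_minnP=> n /asboolP[v0 [Xv0 v0n]] minn minw Xv.
have min0 v1 : gspan X v1 -> len (v0 * w) <= len (v1 * (v0 * w)).
  move=> Xv1; rewrite v0n; apply: minn; apply/asboolP; exists (v1 * v0).
  by rewrite mulgA; split=> //; exact: gspanM.
have lenX v1 : gspan X v1 -> len (v1 * (v0 * w)) = (len v1 + len (v0 * w)%g)%N.
  move=> Xv1; have [r [Xr rv minr]] := minimal_word Xv1.
  rewrite -{1}rv (strongly_minimal_len min0 Xr minr); congr (_ + _)%N.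
  have := @strongly_minimal_len X 1 r; rewrite mulg1 len1 addn0 rv => <- //.
  by rewrite -rv.
suff v01 : v0 = 1 by have := lenX v Xv; rewrite v01 mul1g.
have [[|x r] [/= Xr rv lr]] := gspan_len (gspanV Xv0).
  by apply: invg_inj; rewrite -rv peval_nil invg1.
case/andP: Xr => Xx Xr; have := not_inversion_len (minw x Xx).
have xr : gspan X (peval gen r) by apply/gspan_word; exists r.
have -> : gen x * w = peval gen r * (v0 * w).
  have -> : peval gen r = gen x / v0 by rewrite -rv peval_cons mulgA gen_sq mul1g.
  by rewrite -mulgA mulKg.
have := lenX _ (gspanV Xv0); rewrite mulKg lenX // -lr.
by have := len_le m r; lia.
Qed.

Lemma minimal_uniq X w v : minimal X w -> minimal X (v * w) -> gspan X v -> v = 1.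
Proof.
move=> minw minvw Xv; apply: len_eq0.
have := minimal_len minvw (gspanV Xv); rewrite mulKg (minimal_len minw Xv) lenV.
lia.
Qed.

Lemma minimal1 X : minimal X 1.
Proof. by move=> x _; rewrite inversion1. Qed.

(** Deodhar's lemma: passing from [w] to [w * gen s] changes the inversion status only of the
    conjugate of [gen s] by [w]. *)
Lemma minimal_step X w s : minimal X w -> (forall x, X x -> w * gen s <> gen x * w) ->
  minimal X (w * gen s).
Proof.
move=> minw nlab x Xx; rewrite inversionM (negPf (minw x Xx)) inversion_gen /=.
apply/eqP => e; apply: (nlab x Xx).
by rewrite -e conjgE mulVKg.
Qed.

(* Each element is the product of a representative of minimal length in its
   coset [w W_J] and an element of [W_J]; lengths add, so minimality for [X]
   passes to the representative. *)
Lemma minimal_coset X (J : pred S) w : minimal X w -> exists w0 v,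
  [/\ w = w0 * v, gspan J v, minimal X w0 & minimal J w0^-1].
Proof.
move=> minw.
have: exists n, `[< exists v, gspan J v /\ len (w * v) = n >].
  by exists (len w); apply/asboolP; exists 1; rewrite mulg1; split=> //; exact: gspan1.
case/ex_minnP=> n /asboolP[v [Jv vn]] minn; exists (w * v), v^-1.
have minJ : minimal J (w * v)^-1.
  move=> j Jj; apply/negP => inv; have := inversion_len inv.
  rewrite -(lenV (gen j * _)) invgM invgK gen_inv lenV.
  rewrite vn ltnNge minn //; apply/asboolP; exists (v * gen j).
  by rewrite mulgA; split=> //; apply: gspanM => //; exact: gspan_gen.
split=> //; [by rewrite mulgK|exact: gspanV|].
move=> x Xx; apply/negP => inv; have := inversion_len inv.
have := not_inversion_len (minw x Xx).
have := minimal_len minJ Jv; rewrite -(lenV (v * _)) invgM invgK -mulgA mulgV mulg1 lenV.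
have := lenM (gen x * (w * v)) v^-1; rewrite -mulgA mulgK !lenV.
set a := len (gen x * w); set b := len (w * v); set c := len (gen x * (w * v)).
set d := len v; set e := len w.
lia.
Qed.

(* If [x w0 = w0 q] with [w0] minimal on both sides, comparing lengths forces
   [q] to be a generator. *)
Lemma minimal_conj X (J : pred S) w0 x q : minimal X w0 -> minimal J w0^-1 ->
  X x -> gspan J q -> gen x * w0 = w0 * q -> exists2 j, J j & q = gen j.
Proof.
move=> minX minJ Xx Jq e; have [r [Jr rq lr]] := gspan_len Jq.
have := minimal_len minJ (gspanV Jq); rewrite -invgM !lenV -e => lenx.
have := not_inversion_len (minX x Xx); rewrite lenx.
have := lenM (gen x) w0; rewrite lenx; have := len_gen m x.
case: r Jr rq lr => [|j [|? ?]] //= Jr rq; [lia| |lia].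
by exists j; rewrite -?rq ?peval_cons ?peval_nil ?mulg1 //; case/andP: Jr.
Qed.

End Parabolic.

(** * Dual geometric representation over the algebraic numbers *)

Section GeometricRepresentation.
Local Open Scope ring_scope.
Variables (S : Type) (m : S -> S -> option nat).
Hypothesis hm : coxeter_matrix m.
Notation W := (pgroup (coxeter_rel m)).
Notation gen := (pgen (coxeter_rel m)).

Definition root_of_unity (k : nat) : algC :=
  if pselect (0 < k)%N is left k0 then sval (C_prim_root_exists k0) else 1.

Lemma root_of_unityP k : (0 < k)%N -> k.-primitive_root (root_of_unity k).
Proof. by rewrite /root_of_unity; case: pselect => // k0 _; case: C_prim_root_exists. Qed.

(** This is [2 cos (pi / k)] up to Galois conjugation, the primitive root being arbitrary: only its
    order is used, never positivity. The value at infinity is the limit. *)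
Definition two_cos (o : option nat) : algC :=
  if o is Some k then root_of_unity k.*2 + (root_of_unity k.*2)^-1 else 2.

Definition cartan (s t : S) : algC := if `[< s = t >] then 2 else - two_cos (m s t).

(* The contragredient of the geometric representation, on all functions on S. *)
Definition refl_act (f : S -> algC) (s : S) : S -> algC :=
  fun r => f r - cartan s r * f s.

(* [cheb o i = sin (i pi / k) / sin (pi / k)] for [o = Some k]. *)
Definition cheb (o : option nat) (i : nat) : algC :=
  if o is Some k then
    let z := root_of_unity k.*2 in (z ^+ i - z^-1 ^+ i) / (z - z^-1)
  else i%:R.

Lemma cheb0 o : cheb o 0 = 0.
Proof. by case: o => //= k; rewrite subrr mul0r. Qed.

Lemma root_of_unity_neq0 k : (0 < k)%N -> root_of_unity k != 0.
Proof. by move=> k0; rewrite (prim_root_eq0 (root_of_unityP k0)) -lt0n. Qed.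

Lemma root_of_unity_neqV k : (2 <= k)%N ->
  root_of_unity k.*2 - (root_of_unity k.*2)^-1 != 0.
Proof.
move=> k2; have k0 : (0 < k.*2)%N by lia.
have z0 := root_of_unity_neq0 k0; have := root_of_unityP k0; set z := root_of_unity _ in z0 * => zP.
rewrite subr_eq0; apply/negP => /eqP e.
have /eqP : z ^+ 2 = 1 by rewrite expr2 {2}e divff.
by rewrite -(prim_order_dvd zP) => /dvdn_leq; lia.
Qed.

Lemma root_of_unity_half k : (0 < k)%N -> root_of_unity k.*2 ^+ k = -1.
Proof.
move=> k0; have kk0 : (0 < k.*2)%N by lia.
have := root_of_unityP kk0; set z := root_of_unity _ => zP.
have /eqP := prim_expr_order zP; rewrite -muln2 exprM sqrf_eq1 => /orP[|/eqP//].
by rewrite -(prim_order_dvd zP) => /dvdn_leq; lia.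
Qed.

Definition coxeter_label (o : option nat) := if o is Some k then (2 <= k)%N else true.

Lemma cheb1 o : coxeter_label o -> cheb o 1 = 1.
Proof. by case: o => //= k /root_of_unity_neqV k0; rewrite !expr1 divff. Qed.

Lemma chebSS o i : coxeter_label o ->
  cheb o i.+2 = two_cos o * cheb o i.+1 - cheb o i.
Proof.
case: o => [k /= k2|_ /=]; last by rewrite -[in LHS]addn2 -[in RHS]addn1 !natrD; ring.
have /root_of_unity_neq0 : (0 < k.*2)%N by lia.
have := root_of_unity_neqV k2; set z := root_of_unity _ => zV z0.
rewrite mulrA -mulrBl; congr (_ / _); rewrite !exprS.
have : z * z^-1 = 1 by rewrite divff.
move: z^-1 (z ^+ i) (z^-1 ^+ i) => y a b e.
(* A multiple of [z * y - 1], which vanishes, is added to reach a polynomial identity. *)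
transitivity (z * z * a - y * y * b + (z * y - 1) * (a - b)); last by ring.
by rewrite e subrr mul0r addr0; ring.
Qed.

Lemma cheb_order k : (2 <= k)%N -> cheb (Some k) k = 0.
Proof.
move=> k2; have k0 : (0 < k)%N by lia.
by rewrite /= exprVn root_of_unity_half // invrN1 subrr mul0r.
Qed.

Lemma cheb_order_pred k : (2 <= k)%N -> cheb (Some k) k.-1 = 1.
Proof.
move=> k2; have k0 : (0 < k)%N by lia.
have z0 : root_of_unity k.*2 != 0 by apply: root_of_unity_neq0; lia.
have := root_of_unity_half k0; have := root_of_unity_neqV k2; rewrite /=.
move: (root_of_unity _) z0 => z z0 zV; rewrite -{1}(prednK k0) exprS => e.
have -> : z ^+ k.-1 = - z^-1 by apply: (mulfI z0); rewrite e mulrN divff.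
have -> : z^-1 ^+ k.-1 = - z.
  by apply: (mulfI (invr_neq0 z0)); rewrite -exprS prednK // exprVn -(prednK k0) exprS e invrN1 mulrN mulVf.
by rewrite opprK addrC divff.
Qed.

Lemma cheb_eq0 o i : coxeter_label o -> (0 < i)%N -> cheb o i = 0 ->
  exists2 k, o = Some k & (k %| i)%N.
Proof.
case: o => [k /= k2 i0|_ i0 /= /eqP]; last by rewrite pnatr_eq0; lia.
have k0 : (0 < k.*2)%N by lia.
have z0 := root_of_unity_neq0 k0; have := root_of_unityP k0.
have := root_of_unity_neqV k2; move: (root_of_unity _) z0 => z z0 zV zP.
move/eqP; rewrite mulf_eq0 invr_eq0 (negPf zV) orbF subr_eq0 exprVn => /eqP e.
exists k => //; have /eqP : z ^+ (i.*2) = 1.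
  by rewrite -addnn exprD {2}e divff // expf_neq0.
by rewrite -(prim_order_dvd zP) -!muln2 dvdn_pmul2r.
Qed.

Lemma coxeter_labelP s t : s <> t -> coxeter_label (m s t).
Proof.
case: hm => _ _ m2 st; case e: (m s t) => [k|//]; exact: m2 e.
Qed.

Lemma cartan_diag s : cartan s s = 2.
Proof. by rewrite /cartan asboolT. Qed.

Lemma cartan_neq s t : s <> t -> cartan s t = - two_cos (m s t).
Proof. by move=> st; rewrite /cartan asboolF. Qed.

Lemma refl_actE f s r : refl_act f s r = f r - cartan s r * f s.
Proof. by []. Qed.

Lemma refl_act_diag f s : refl_act f s s = - f s.
Proof. by rewrite refl_actE cartan_diag; ring. Qed.

Lemma refl_actK f s : refl_act (refl_act f s) s = f.
Proof. by apply/funext => r; rewrite refl_actE refl_act_diag refl_actE; ring. Qed.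

(** The coordinates at [s] and [t] evolve among themselves, by the Chebyshev recursion [chebSS]. *)
Lemma refl_act_zig f s t n : s <> t ->
  let u := cheb (m s t) in let g := foldl refl_act f (zig s t n) in
  g (if odd n then t else s) = u n.+1 * f s + u n * f t /\
  g (if odd n then s else t) =
    - (u n * f s + (two_cos (m s t) * u n - u n.+1) * f t).
Proof.
move=> st u; have lab := coxeter_labelP st.
have ts : t <> s by move/esym.
have mts : m t s = m s t by case: hm => _ ->.
elim: n => [|n]; first by rewrite /u cheb0 cheb1 //=; split; ring.
rewrite zigSr foldl_rcons; set g := foldl _ _ _.
have uSS : u n.+2 = two_cos (m s t) * u n.+1 - u n by exact: chebSS.
rewrite /=; case: odd => /= -[g1 g2]; split; rewrite ?refl_act_diag ?g1 ?uSS; try ring.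
- by rewrite refl_actE g1 g2 cartan_neq // mts; ring.
- by rewrite refl_actE g1 g2 cartan_neq //; ring.
Qed.

(** The factor [cheb] works both ways: its vanishing at [m s t] gives the braid relations, its
    nonvanishing elsewhere the exact orders in [gen_order]. *)
Lemma refl_act_zigB f s t n r : s <> t ->
  foldl refl_act f (zig s t n) r - foldl refl_act f (zig t s n) r =
  cheb (m s t) n * (if odd n then f t * cartan t r - f s * cartan s r
                    else f t * cartan s r - f s * cartan t r).
Proof.
move=> st; have ts : t <> s by move/esym.
have mts : m t s = m s t by case: hm => _ ->.
elim: n => [|n IH]; first by rewrite cheb0 /= subrr mul0r.
rewrite !zigSr !foldl_rcons !refl_actE opprD addrACA IH.
have [c1 _] := refl_act_zig f n st; have [c2 _] := refl_act_zig f n ts.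
move: c1 c2; rewrite mts [odd n.+1]/=; move: (cheb _) => u.
by case: (odd n) => /= -> ->; ring.
Qed.

Definition dual_act f (w : W) := foldl refl_act f [seq l.1 | l <- prepr w].

Lemma dual_act_word f u : dual_act f (peval gen u) = foldl refl_act f u.
Proof.
apply: (coxeter_word_foldl (I := fun=> True)) => //.
- by move=> g s _; exact: refl_actK.
- move=> g s t k _ st mst; apply/funext => r; apply/eqP.
  have k2 : (2 <= k)%N by case: hm => _ _ /(_ s t k st mst).
  by rewrite -subr_eq0 refl_act_zigB // mst cheb_order // mul0r.
- by rewrite -weval_fst weval_prepr.
Qed.

Lemma dual_act1 f : dual_act f 1%g = f.
Proof. by rewrite -(peval_nil gen) dual_act_word. Qed.

Lemma dual_actM f v w : dual_act f (v * w)%g = dual_act (dual_act f v) w.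
Proof.
have [u <-] := coxeter_word v; have [u' <-] := coxeter_word w.
by rewrite -peval_cat !dual_act_word foldl_cat.
Qed.

Lemma dual_act_gen f s : dual_act f (gen s) = refl_act f s.
Proof.
have -> : gen s = peval gen [:: s] by rewrite peval_cons peval_nil mulg1.
by rewrite dual_act_word.
Qed.

(** The counterpart of (v3) for roots: [cheb] is 0 at [k] and 1 at [k.-1], so one term survives. *)
Lemma dual_act_alt f s t k : s <> t -> m s t = Some k ->
  dual_act f (peval gen (alt s t k.-1)) s = f (if odd k then t else s).
Proof.
move=> st mst; have ts : t <> s by move/esym.
have mts : m t s = Some k by case: hm => _ <-.
have k2 : (2 <= k)%N by case: hm => _ _ /(_ s t k st mst).
have ok : odd k = ~~ odd k.-1 by case: (k) k2.
have [c1 _] := refl_act_zig f k.-1 st; have [c2 _] := refl_act_zig f k.-1 ts.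
move: c1 c2; rewrite dual_act_word alt_zig mst mts ok prednK 1?ltnW //.
rewrite cheb_order // cheb_order_pred // !mul0r !add0r !mul1r.
by case: odd.
Qed.

Definition indicator (s : S) : S -> algC := fun t => `[< t = s >]%:R.

Lemma dual_act_gspan (X : pred S) (f : S -> algC) (w : W) : (forall x, X x -> f x = 0) -> gspan X w ->
  dual_act f w = f.
Proof.
move=> fX /gspan_word[u Xu <-]; rewrite dual_act_word.
elim: u Xu => //= s u IH /andP[Xs /IH {2}<-]; congr foldl.
by apply/funext => r; rewrite refl_actE (fX s Xs) mulr0 subr0.
Qed.

(** If [s] were outside [X], its indicator would vanish on [X], hence be fixed by the subgroup, yet
    [gen s] negates it at [s]. *)
Lemma gspan_genP (X : pred S) s : gspan X (gen s) -> X s.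
Proof.
move=> Xs; apply/negPn/negP => nXs.
have /dual_act_gspan/(_ Xs) : forall x, X x -> indicator s x = 0.
  by move=> x Xx; rewrite /indicator asboolF // => xs; rewrite -xs Xx in nXs.
move=> /(congr1 (@^~ s)); rewrite dual_act_gen refl_act_diag /indicator asboolT //.
by move/eqP; rewrite eq_sym -subr_eq0 opprK -natrD pnatr_eq0.
Qed.

Lemma gen_inj : injective gen.
Proof.
move=> s t st; have := @gspan_genP (fun x => `[< x = t >]) s.
by rewrite st => /(_ _)/asboolP; apply; apply: gspan_gen; apply/asboolP.
Qed.

Lemma gen_order s t k : s <> t -> (0 < k)%N -> ((gen s * gen t) ^+ k = 1)%g ->
  exists2 j, m s t = Some j & (j %| k)%N.
Proof.
move=> st k0 /(zig_eq_expg (gen_sq m))/(congr1 (dual_act (indicator t))).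
rewrite !dual_act_word => e; apply: (cheb_eq0 (coxeter_labelP st) k0).
(* The coordinate is chosen by parity so that the surviving [cartan] entry is diagonal, hence 2. *)
have := refl_act_zigB (indicator t) k (if odd k then t else s) st.
have -> : indicator t s = 0 by rewrite /indicator asboolF.
have -> : indicator t t = 1 by rewrite /indicator asboolT.
rewrite e subrr; case: odd; rewrite cartan_diag mul0r mul1r subr0 => /esym/eqP;
  by rewrite mulf_eq0 pnatr_eq0 orbF => /eqP.
Qed.

(** Conjugate products have the same order, and orders recover labels; divisibility is obtained in
    both directions. *)
Lemma gen_conj_label w s t x y k : s <> t -> m s t = Some k ->
  (w * gen s = gen x * w)%g -> (w * gen t = gen y * w)%g -> x <> y /\ m x y = Some k.
Proof.
move=> st mst sx ty.
have xy : x <> y.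
  by move=> xy; apply/st/gen_inj/(mulgI w); rewrite sx ty xy.
have conj n : (w * (gen s * gen t) ^+ n = (gen x * gen y) ^+ n * w)%g.
  elim: n => [|n IH]; first by rewrite mulg1 mul1g.
  by rewrite !expgSr mulgA IH -!mulgA [(w * _)%g]mulgA sx -mulgA ty.
have k2 : (2 <= k)%N by case: hm => _ _ /(_ s t k st mst).
have [||j mxy jk] := @gen_order x y k xy; first lia.
  by apply: (mulIg w); rewrite -conj (gen_braid st mst) mulg1 mul1g.
have j2 : (2 <= j)%N by case: hm => _ _ /(_ x y j xy mxy).
have [||i] := @gen_order s t j st; first lia.
  by apply: (mulgI w); rewrite conj (gen_braid xy mxy) mulg1 mul1g.
rewrite mst => -[<-] kj; split=> //; rewrite mxy; congr Some.
by apply/eqP; rewrite eqn_dvd jk.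
Qed.

End GeometricRepresentation.

(** * Artin groups *)

Section Retraction.
Variables (S : Type) (m : S -> S -> option nat).
Hypothesis hm : coxeter_matrix m.
Variable Y : pred S.
Notation W := (pgroup (coxeter_rel m)).
Notation gen := (pgen (coxeter_rel m)).
Notation A := (pgroup (artin_rel m)).
Notation agen := (pgen (artin_rel m)).
Implicit Types (w v : W) (a : A).

Lemma agen_zig s t k : s <> t -> m s t = Some k ->
  peval agen (zig s t k) = peval agen (zig t s k).
Proof.
move=> st mst; apply: alt_rel; apply: respects_pgen.
by exists s, t, k.
Qed.

Definition label w s : option S :=
  if pselect (exists y, Y y /\ w * gen s = gen y * w) is left ex
  then Some (sval (cid ex)) else None.

Lemma labelP w s y : label w s = Some y <-> Y y /\ w * gen s = gen y * w.
Proof.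
rewrite /label; case: pselect => [ex|nex]; last by split=> // h; case: nex; exists y.
case: cid => z /= [Yz ez]; split=> [[<-]//|[Yy ey]]; congr Some.
by apply/(gen_inj hm)/(mulIg w); rewrite -ez.
Qed.

Lemma label_None w s : label w s = None -> forall y, Y y -> w * gen s <> gen y * w.
Proof. by move=> ln y Yy e; have /labelP := conj Yy e; rewrite ln. Qed.

Lemma label_move w s : label w s = None -> label (w * gen s) s = None.
Proof.
move=> ln; case e: label => [y|//]; move/labelP: e => [Yy].
rewrite -mulgA gen_sq mulg1 => e; case: (label_None ln Yy).
by rewrite [in RHS]e mulgA gen_sq mul1g.
Qed.

(** The state [w] represents its coset modulo the subgroup generated by [Y] on the left. If [w]
    conjugates the letter into [Y], the coset stays and the conjugate is emitted; otherwise
    [minimal_step] keeps the new representative minimal. *)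
Definition retract_act (x : W * A) (l : S * bool) : W * A :=
  if label x.1 l.1 is Some y then (x.1, x.2 * (if l.2 then (agen y)^-1 else agen y))
  else (x.1 * gen l.1, x.2).

Notation rstep := (fun x s => retract_act x (s, false)).

Lemma retract_zig_const w a s t x y n :
  label w s = Some x -> label w t = Some y ->
  foldl rstep (w, a) (zig s t n) = (w, a * peval agen (zig x y n)).
Proof.
elim: n a s t x y => [|n IH] a s t x y ls lt /=; first by rewrite peval_nil mulg1.
by rewrite /retract_act /= ls (IH _ _ _ y x) // peval_cons mulgA.
Qed.

(** With one possible label [x0], only the number of emissions matters. It is the number of
    reflections of the word that [w0 * v] conjugates into [Y], hence the same for both sides of a
    braid relation. The factor [gen x0 ^+ N] accounts for the letters on which the state did not
    move. *)
Lemma retract_zig_count w0 v a s t x0 (J : pred S) n :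
  J s -> J t -> gspan J v ->
  (forall q y, gspan J q -> Y y -> gen y * w0 = w0 * q -> y = x0) ->
  let N := (\sum_(i < n) `[< exists y, Y y /\
    w0 * v * ((gen s * gen t) ^+ i * gen s) = gen y * (w0 * v) >]%g)%N in
  foldl rstep (w0 * v, a) (zig s t n) =
    (gen x0 ^+ N * (w0 * v) * peval gen (zig s t n), a * agen x0 ^+ N).
Proof.
move=> Js Jt Jv x0P.
pose c (p : W) : bool := `[< exists y, Y y /\ w0 * v * p = gen y * (w0 * v) >].
pose N n := (\sum_(i < n) c ((gen s * gen t) ^+ i * gen s)%g)%N.
rewrite /= -/(N n).
set w := w0 * v in c N *.
suff [] : foldl rstep (w, a) (zig s t n) =
    (gen x0 ^+ N n * w * peval gen (zig s t n), a * agen x0 ^+ N n) /\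
    exists2 v', gspan J v' & gen x0 ^+ N n * w * peval gen (zig s t n) = w0 * v'.
  by [].
elim: n => [|n [IH [v' Jv' ev']]].
  rewrite /N big_ord0 !mulg1 mul1g peval_nil mulg1; split=> //; by exists v.
rewrite zigSr foldl_rcons IH peval_rcons; set l := if _ then _ else _.
have Jl : gspan J (gen l) by apply: gspan_gen; rewrite /l; case: odd.
set g := peval _ _ in ev' *; set p := (gen s * gen t) ^+ n * gen s.
have gl : g * gen l = p * g by exact: zig_reflection (gen_sq m) s t n.
have NS : N n.+1 = (N n + c p)%N by rewrite /N big_ord_recr.
have Jp : gspan J p.
  rewrite /p; elim: (n) => [|i IHi]; first by rewrite mul1g; exact: gspan_gen.
  by rewrite expgS -!mulgA; apply: gspanM (gspan_gen Js) (gspanM (gspan_gen Jt) IHi).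
clearbody p; set X := gen x0 ^+ N n in ev' *.
have comX : X * gen x0 = gen x0 * X by rewrite -expgS -expgSr.
set w' := X * w * g in ev' *.
have w'l : w' * gen l = X * (w * p) * g by rewrite /w' -!mulgA gl !mulgA.
(* Since [gen x0] commutes with [X], the test at the current state becomes a test on the starting
   element and the reflection [p]. *)
have key : w' * gen l = gen x0 * w' <-> w * p = gen x0 * w.
  rewrite w'l /w'; split=> [e|->]; last by rewrite !mulgA comX.
  by apply: (mulgI X); apply: (mulIg g); rewrite e !mulgA comX.
have labx0 y : Y y -> w' * gen l = gen y * w' -> y = x0.
  move=> Yy ey; apply: (x0P (v' * gen l * v'^-1)) => //.
    by apply: gspanM (gspanM Jv' Jl) (gspanV Jv').
  by rewrite !mulgA -ev' ey ev' -!mulgA mulgV mulg1.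
rewrite {1}/retract_act /=; case e: label => [y|].
  move/labelP: e => [Yy ey]; have yx0 := labx0 _ Yy ey; rewrite {}yx0 in Yy ey *.
  have NS1 : N n.+1 = (N n).+1 by rewrite NS /c asboolT ?addn1 //; exists x0; split=> //; apply/key.
  have step : gen x0 ^+ N n.+1 * w * (g * gen l) = w'.
    transitivity (gen x0 * (w' * gen l)); first by rewrite NS1 expgS !mulgA.
    by rewrite ey mulgA gen_sq mul1g.
  by rewrite step NS1 expgSr mulgA; split=> //; exists v'.
have NS0 : N n.+1 = N n.
  rewrite NS /c asboolF ?addn0 // => -[y [Yy ey]].
  have yx0 : y = x0.
    apply: (x0P (v * p * v^-1)) => //; first exact: gspanM (gspanM Jv Jp) (gspanV Jv).
    by rewrite !mulgA -/w ey /w -!mulgA mulgV mulg1.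
  by rewrite yx0 in ey Yy; apply: (label_None e Yy); apply/key.
rewrite NS0 mulgA -/X -/w'; split=> //.
by exists (v' * gen l); [exact: gspanM|rewrite ev' mulgA].
Qed.

(** Here [w0] conjugates the subgroup of [J] into that of [Y], so [w0 * v] lies in the same coset as
    [w0]. *)
Lemma minimal_absorb w0 v (J : pred S) :
  (forall j, J j -> exists2 y, Y y & w0 * gen j = gen y * w0) ->
  gspan J v -> minimal Y w0 -> minimal Y (w0 * v) -> v = 1.
Proof.
move=> absorb Jv min0 minv.
have [u Yu e] : exists2 u, gspan Y u & w0 * v = u * w0.
  have /gspan_word[r Jr <-] := Jv; elim: r Jr => [|j r IH].
    by exists 1; rewrite ?peval_nil ?mulg1 ?mul1g //; exact: gspan1.
  case/andP=> /absorb[y Yy ey] /IH[u Yu eu]; exists (gen y * u).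
    exact: gspanM (gspan_gen Yy) Yu.
  by rewrite peval_cons mulgA ey -mulgA eu mulgA.
rewrite e in minv; have u1 := minimal_uniq min0 minv Yu.
by apply: (mulgI w0); rewrite e u1 mul1g mulg1.
Qed.

(** Writing [w = w0 * v] with [v] in the dihedral subgroup, two distinct labels force [w0] to
    conjugate both letters into [Y] and [v = 1], so a braid relation of the Artin group is emitted;
    otherwise counting suffices. *)
Lemma retract_zig w a s t k : minimal Y w -> s <> t -> m s t = Some k ->
  foldl rstep (w, a) (zig s t k) = foldl rstep (w, a) (zig t s k).
Proof.
move=> minw st mst; pose J : pred S := fun r => `[< r = s \/ r = t >].
have Js : J s by apply/asboolP; left.
have Jt : J t by apply/asboolP; right.
have [w0 [v [ew Jv min0 minJ]]] := minimal_coset J minw.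
pose lab y := exists2 q, gspan J q & gen y * w0 = w0 * q.
have [[y [y' [Yy Yy' ly ly' yy']]]|one] :=
    pselect (exists y y', [/\ Y y, Y y', lab y, lab y' & y <> y']).
  have labJ z : Y z -> lab z -> exists2 j, J j & gen z * w0 = w0 * gen j.
    by move=> Yz [q Jq e]; have [j Jj qj] := minimal_conj min0 minJ Yz Jq e; exists j; rewrite -?qj.
  have [j Jj ej] := labJ y Yy ly; have [j' Jj' ej'] := labJ y' Yy' ly'.
  have jj' : j <> j' by move=> jj'; apply/yy'/(gen_inj hm)/(mulIg w0); rewrite ej ej' jj'.
  have [[x Yx ex] [x' Yx' ex']] : (exists2 x, Y x & w0 * gen s = gen x * w0) /\
      (exists2 x, Y x & w0 * gen t = gen x * w0).
    move/asboolP: Jj jj' ej; move/asboolP: Jj' ej' => [] -> ej' [] -> // _ ej.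
    - by split; [exists y'|exists y].
    - by split; [exists y|exists y'].
  have v1 : v = 1.
    apply: (minimal_absorb (w0 := w0) (J := J)) => //; last by rewrite -ew.
    by move=> r /asboolP[] ->; [exists x|exists x'].
  rewrite v1 mulg1 in ew; rewrite ew.
  have ls : label w0 s = Some x by apply/labelP.
  have lt : label w0 t = Some x' by apply/labelP.
  have [xx' mxx'] := gen_conj_label hm st mst ex ex'.
  by rewrite (retract_zig_const _ _ ls lt) (retract_zig_const _ _ lt ls) (agen_zig xx' mxx').
have [x0 x0P] : exists x0, forall q y, gspan J q -> Y y -> gen y * w0 = w0 * q -> y = x0.
  have [[y [Yy ly]]|none] := pselect (exists y, Y y /\ lab y).
    exists y => q z Jq Yz ez; apply: contrapT => yz; apply: one.
    by exists z, y; split=> //; exists q.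
  (* Without any label the condition is vacuous and [s] is an arbitrary default. *)
  by exists s => q y Jq Yy ey; case: none; exists y; split=> //; exists q.
rewrite ew (retract_zig_count a k Js Jt Jv x0P) (retract_zig_count a k Jt Js Jv x0P).
have := sum_reflection_rev (fun p => `[< exists y, Y y /\ w0 * v * p = gen y * (w0 * v) >]) st mst.
by rewrite /= => ->; rewrite (gen_zig st mst).
Qed.

Lemma retract_pres_eq (u v : seq (S * bool)) (x : W * A) : pres_eq (artin_rel m) u v -> minimal Y x.1 ->
  foldl retract_act x u = foldl retract_act x v.
Proof.
move=> uv; apply: (foldl_pres_eq (I := fun x => minimal Y x.1)) uv x.
- move=> [w a] [s b] /= minw; rewrite /retract_act /=.
  by case e: label => [//|]; apply: minimal_step => //; exact: label_None.
- move=> [w a] s b /= minw; rewrite /retract_act /=; case e: (label w s) => [y|] /=.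
    by rewrite e -mulgA; case: b; rewrite /= ?mulVg ?mulgV mulg1.
  by rewrite label_move // -mulgA gen_sq mulg1.
- move=> ? ? [w a] [s [t [k [st [mst [-> ->]]]]]] minw.
  exact: (zig_rel (f := foldl rstep (w, a)) (retract_zig a minw st mst)).
Qed.

Lemma retract_fix u a : all (fun l => Y l.1) u ->
  foldl retract_act (1, a) u = (1, a * weval agen u).
Proof.
elim: u a => [|[s b] u IH] a; first by rewrite weval_nil mulg1.
case/andP=> /= Ys Yu; rewrite /retract_act /=.
have -> : label 1 s = Some s by apply/labelP; rewrite mul1g mulg1.
by rewrite IH // weval_cons mulgA.
Qed.

(** An emitted generator is a conjugate of a letter in [X] by an element of the subgroup of [X], so
    [gspan_genP] puts it in [X]. *)
Lemma retract_gspan (X : pred S) u w a : all (fun l => X l.1) u -> gspan X w ->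
  gspan [predI X & Y] a -> gspan [predI X & Y] (foldl retract_act (w, a) u).2.
Proof.
elim: u w a => [|[s b] u IH] w a //= /andP[Xs Xu] Xw XYa; rewrite /retract_act /=.
case e: label => [y|]; apply: IH => //; last exact: gspanM Xw (gspan_gen Xs).
move/labelP: e => [Yy ey]; apply: gspanM => //.
have XYy : [predI X & Y] y.
  apply/andP; split=> //; apply: (gspan_genP hm); rewrite /in_mem /=; rewrite -[gen y](mulgK w) -ey.
  exact: gspanM (gspanM Xw (gspan_gen Xs)) (gspanV Xw).
by case: b; [apply: gspanV|]; exact: gspan_gen.
Qed.

(* Van der Lek's theorem, by the retraction of Charney and Paris. *)
Lemma artin_gspanI (X : pred S) a : gspan X a -> gspan Y a -> gspan [predI X & Y] a.
Proof.
move=> [u Xu ua] [v Yv va]; rewrite -va -[weval _ v]mul1g.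
have -> : 1 * weval agen v = (foldl retract_act (1, 1) v).2 by rewrite retract_fix.
have /weval_eqP/retract_pres_eq <- : weval agen u = weval agen v by rewrite ua.
  by apply: retract_gspan => //; exact: gspan1.
exact: minimal1.
Qed.

End Retraction.

Section Automorphism.
Variables (S : Type) (m : S -> S -> option nat) (theta : S -> S).
Hypotheses (thetaK : involutive theta)
  (theta_m : forall s t, m (theta s) (theta t) = m s t).
Notation A := (pgroup (artin_rel m)).
Notation agen := (pgen (artin_rel m)).

Definition artin_aut : A -> A := plift (agen \o theta).

Lemma respects_artin (G : groupType) (f : S -> G) :
  (forall s t k, s <> t -> m s t = Some k ->
     peval f (zig s t k) = peval f (zig t s k)) -> respects (artin_rel m) f.
Proof. by move=> fz _ _ [s [t [k [st [mst [-> ->]]]]]]; apply: zig_rel (fz _ _ _ st mst). Qed.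

Lemma peval_map_zig (G : groupType) (L : Type) (f : L -> S) (h : S -> G) a b n :
  peval (h \o f) (zig a b n) = peval h (zig (f a) (f b) n).
Proof. by elim: n a b => [|n IH] a b /=; rewrite ?peval_nil // !peval_cons IH. Qed.

Lemma artin_aut_respects : respects (artin_rel m) (agen \o theta).
Proof.
apply: respects_artin => s t k st mst; rewrite !peval_map_zig.
apply: agen_zig; last by rewrite theta_m.
by move/(can_inj thetaK).
Qed.

Lemma artin_aut_word u :
  artin_aut (weval agen u) = weval agen [seq (theta l.1, l.2) | l <- u].
Proof.
rewrite /artin_aut plift_weval; last exact: artin_aut_respects.
by rewrite /weval big_map.
Qed.

Lemma artin_autM : {morph artin_aut : x y / x * y}.
Proof. exact: pliftM artin_aut_respects. Qed.

Lemma artin_autK : involutive artin_aut.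
Proof.
move=> g; rewrite -[in LHS](weval_prepr g) !artin_aut_word -map_comp.
rewrite -[RHS]weval_prepr -[in RHS](map_id (prepr g)); congr weval.
by apply: eq_map => -[s b] /=; rewrite thetaK.
Qed.

End Automorphism.

(** * Splitting along two unrelated generators *)

Section Splitting.
Variables (S : Type) (m : S -> S -> option nat) (b b' : S).
Hypotheses (msym : forall s t, m s t = m t s) (bb' : b <> b') (mbb' : m b b' = None).
Notation A := (pgroup (artin_rel m)).
Notation agen := (pgen (artin_rel m)).
Notation letter l := (if l.2 then (agen l.1)^-1 else agen l.1).

Definition avoid (s t : S) : pred S := fun r => `[< r <> s /\ r <> t >].

(** Edges of the tree are left cosets of the subgroup avoiding [b] and [b']; the value is 1 exactly
    on the base edge. *)
Definition in_edge (g : A) : int := Posz `[< gspan (avoid b b') g >].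

Lemma in_edge_mul (g h : A) : gspan (avoid b b') h -> in_edge (g * h) = in_edge g.
Proof.
move=> hC; congr (Posz (nat_of_bool _)); apply: asbool_equiv_eq; split=> gC.
  by rewrite -(mulgK h g); exact: gspanM gC (gspanV hC).
exact: gspanM.
Qed.

(* In the Bass-Serre tree of the splitting of A over the subgroup avoiding
   [b] and [b'], this counts the signed passages of a path through the base
   edge along letters [c]. *)
Definition crossing_act (c : S) (x : int * A) (l : S * bool) : int * A :=
  ((x.1 + (if `[< l.1 = c >] then in_edge (x.2 * letter l)%g - in_edge x.2 else 0))%R,
   x.2 * letter l).

Lemma crossing_snd c x u : (foldl (crossing_act c) x u).2 = x.2 * weval agen u.
Proof.
elim: u x => [|l u IH] x /=; first by rewrite weval_nil mulg1.
by rewrite IH weval_cons mulgA.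
Qed.

Lemma crossing_none c x u : all (fun l : S * bool => ~~ `[< l.1 = c >]) u ->
  (foldl (crossing_act c) x u).1 = x.1.
Proof.
elim: u x => [//|l u IH] x /= /andP[lc uc].
by rewrite IH // /crossing_act /= (negPf lc) GRing.addr0.
Qed.

(** Only the letters [b] and [b'] change the edge, so the two counts together telescope. *)
Lemma crossing_sum x y u : x.2 = y.2 ->
  ((foldl (crossing_act b) x u).1 + (foldl (crossing_act b') y u).1 =
   x.1 + y.1 + (in_edge (x.2 * weval agen u)%g - in_edge x.2))%R.
Proof.
elim: u x y => [|l u IH] x y xy /=.
  by rewrite weval_nil mulg1 GRing.subrr GRing.addr0.
rewrite IH /= ?xy // weval_cons mulgA -xy.
have [lb|lb] := pselect (l.1 = b).
  rewrite (asboolT lb) (@asboolF (l.1 = b')) ?lb //=; ring.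
have [lb'|lb'] := pselect (l.1 = b').
  rewrite (asboolT lb') (asboolF lb) /=; ring.
rewrite (asboolF lb) (asboolF lb') [in_edge (x.2 * letter l)]in_edge_mul /=; first by ring.
have lC : gspan (avoid b b') (agen l.1) by apply: gspan_gen; apply/asboolP.
by case: l.2 => //; exact: gspanV.
Qed.

Lemma crossing_avoid x u : all (fun l : S * bool => ~~ `[< l.1 = b' >]) u ->
  (foldl (crossing_act b) x u).1 =
  (x.1 + (in_edge (x.2 * weval agen u)%g - in_edge x.2))%R.
Proof.
move=> ub'; have := @crossing_sum x (0%R, x.2) u erefl.
by rewrite (crossing_none _ ub') /= ?GRing.addr0 => ->; ring.
Qed.

Lemma all_zig (p : pred S) s t k : p s -> p t -> all p (zig s t k).
Proof. by elim: k s t => //= k IH s t ps pt; rewrite ps IH. Qed.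

(** As [m b b'] is infinite, no relation contains both letters: without [b] nothing is counted, and
    without [b'] the count telescopes and depends only on the endpoints. *)
Lemma crossing_zig x s t k : s <> t -> m s t = Some k ->
  foldl (crossing_act b) x (pos_word (zig s t k)) =
  foldl (crossing_act b) x (pos_word (zig t s k)).
Proof.
move=> st mst; rewrite [LHS]surjective_pairing [RHS]surjective_pairing !crossing_snd.
rewrite !weval_pos (agen_zig st mst); congr (_, _).
have [p [ps pt pE]] : exists c, [/\ ~~ `[< s = c >], ~~ `[< t = c >] & c = b \/ c = b'].
  have [sb|sb] := pselect (s = b).
    exists b'; split; [| |by right]; apply/asboolPn => //.
    - by rewrite sb.
    - by move=> tb'; rewrite sb tb' mbb' in mst.
  have [tb|tb] := pselect (t = b); last by exists b; split; [| |by left]; apply/asboolPn.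
  exists b'; split; [| |by right]; apply/asboolPn; last by rewrite tb.
  by move=> sb'; rewrite tb sb' msym mbb' in mst.
have az r r' : ~~ `[< r = p >] -> ~~ `[< r' = p >] ->
    all (fun l : S * bool => ~~ `[< l.1 = p >]) (pos_word (zig r r' k)).
  by move=> *; rewrite all_map; exact: all_zig.
have [azs azt] := (az s t ps pt, az t s pt ps).
case: pE azs azt => -> azs azt; first by rewrite !crossing_none.
by rewrite !crossing_avoid // !weval_pos (agen_zig st mst).
Qed.

Lemma crossing_pres_eq x u v : pres_eq (artin_rel m) u v ->
  foldl (crossing_act b) x u = foldl (crossing_act b) x v.
Proof.
move=> uv; apply: (foldl_pres_eq (I := fun=> True)) uv x _ => //.
- move=> [n g] s e _; rewrite /crossing_act /=.
  have -> : g * (if e then (agen s)^-1 else agen s) * (if ~~ e then (agen s)^-1 else agen s) = g.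
    by case: e; rewrite /= ?mulgK ?mulgVK.
  congr (_, _); case: asbool; ring.
- move=> _ _ x [s [t [k [st [mst [-> ->]]]]]] _; rewrite -!foldl_pos_word.
  exact: (zig_rel (f := fun u => foldl _ x (pos_word u)) (crossing_zig x st mst)).
Qed.

Variable theta : S -> S.
Hypotheses (thetaK : involutive theta)
  (theta_m : forall s t, m (theta s) (theta t) = m s t) (thetab : theta b = b').

Lemma in_edge_aut (g : A) : in_edge (artin_aut theta g) = in_edge g.
Proof.
have aut (h : A) : gspan (avoid b b') h -> gspan (avoid b b') (artin_aut theta h).
  move=> [u uC <-]; rewrite artin_aut_word //.
  eexists; last by reflexivity.
  rewrite all_map; apply: sub_all uC => l /asboolP[lb lb'] /=; apply/asboolP; split=> e.
    by apply: lb'; rewrite -thetab -e thetaK.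
  by apply/lb/(can_inj thetaK); rewrite thetab.
congr (Posz (nat_of_bool _)); apply: asbool_equiv_eq; split; last exact: aut.
by move/aut; rewrite artin_autK.
Qed.

Lemma crossing_aut n (g : A) u :
  (foldl (crossing_act b) (n, artin_aut theta g) [seq (theta l.1, l.2) | l <- u]).1 =
  (foldl (crossing_act b') (n, g) u).1.
Proof.
elim: u n g => [//|[s e] u IH] n g /=; rewrite /crossing_act /=.
have -> : artin_aut theta g * (if e then (agen (theta s))^-1 else agen (theta s)) =
    artin_aut theta (g * (if e then (agen s)^-1 else agen s)).
  have := artin_aut_word thetaK theta_m [:: (s, e)].
  by rewrite artin_autM // !weval1 /= => ->.
rewrite IH !in_edge_aut.
have -> // : `[< theta s = b >] = `[< s = b' >].
apply: asbool_equiv_eq; split=> es; first by rewrite -thetab -es thetaK.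
by rewrite es -thetab thetaK.
Qed.

(* The automorphism reverses the base edge, hence exchanges the two counts; if
   it fixes the element, their sum [in_edge g - 1] is even. *)
Lemma artin_fixed_avoid u :
  weval agen [seq (theta l.1, l.2) | l <- u] = weval agen u ->
  gspan (avoid b b') (weval agen u).
Proof.
move=> /weval_eqP fixu; have := @crossing_sum (0%R, 1) (0%R, 1) u erefl.
rewrite -crossing_aut /artin_aut (plift1 (artin_aut_respects thetaK theta_m)).
rewrite (crossing_pres_eq _ fixu) /= mul1g; have -> : in_edge 1 = 1%R by rewrite /in_edge asboolT //; exact: gspan1.
rewrite /in_edge; case: asboolP => // _ /=.
set n := (foldl _ _ _).1; lia.
Qed.

End Splitting.

(** * Virtual Artin groups *)

Lemma map_alt (T U : Type) (f : T -> U) b a n :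
  [seq f x | x <- alt b a n] = alt (f b) (f a) n.
Proof. by elim: n a b => //= n IH a b; rewrite map_rcons IH. Qed.

Lemma peval_map (T U : Type) (G : groupType) (f : T -> U) (h : U -> G) u :
  peval h [seq f x | x <- u] = peval (h \o f) u.
Proof. exact: big_map. Qed.

Lemma peval_conj (T : Type) (G : groupType) (f : T -> G) (g : G) u :
  peval (fun x => f x ^ g) u = peval f u ^ g.
Proof.
elim: u => [|x u IH]; first by rewrite !peval_nil conj1g.
by rewrite !peval_cons IH conjMg.
Qed.

Section VirtualArtin.
Variables (S : countType) (m : S -> S -> option nat).
Hypothesis hm : coxeter_matrix m.
Notation W := (pgroup (coxeter_rel m)).
Notation V := (pgroup (va_rel m)).
Notation wgen := (pgen (coxeter_rel m)).
Notation vgen := (pgen (va_rel m)).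

Lemma va_sigma s t k : s <> t -> m s t = Some k ->
  peval (vgen \o @sigma S) (alt t s k) = peval (vgen \o @sigma S) (alt s t k).
Proof.
move=> st mst; rewrite -!(peval_map (@sigma S) vgen) !map_alt; apply: respects_pgen.
by left; exists s, t, k.
Qed.

Lemma va_mixed s t k : s <> t -> m s t = Some k ->
  peval (vgen \o @tau S) (alt s t k.-1) * vgen (sigma s) =
  vgen (sigma (if odd k then t else s)) * peval (vgen \o @tau S) (alt s t k.-1).
Proof.
move=> st mst; rewrite -!(peval_map (@tau S) vgen) !map_alt -peval_rcons -peval_cons -cats1.
by apply: respects_pgen; do 3 right; exists s, t, k.
Qed.

Lemma respects_va (G : groupType) (f : va_letter S -> G) :
  respects (coxeter_rel m) (f \o @tau S) -> respects (artin_rel m) (f \o @sigma S) ->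
  (forall s t k, s <> t -> m s t = Some k ->
     peval (f \o @tau S) (alt s t k.-1) * f (sigma s) =
     f (sigma (if odd k then t else s)) * peval (f \o @tau S) (alt s t k.-1)) ->
  respects (va_rel m) f.
Proof.
move=> ftau fsigma fmix u v [|[|[|]]].
- move=> [s [t [k [st [mst [-> ->]]]]]]; rewrite -!map_alt !peval_map.
  by apply: fsigma; exists s, t, k.
- move=> [s [t [k [st [mst [-> ->]]]]]]; rewrite -!map_alt !peval_map.
  by apply: ftau; right; exists s, t, k.
- move=> [s [-> ->]]; have := ftau [:: s; s] [::].
  by rewrite !peval_cons !peval_nil; apply; left; exists s.
- move=> [s [t [k [st [mst [-> ->]]]]]]; rewrite -!map_alt cats1 peval_rcons peval_cons.
  by rewrite !peval_map fmix.
Qed.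

Definition va_to_W (f : S -> W) (l : va_letter S) : W :=
  match l with sigma s => f s | tau s => wgen s end.

Definition projK : V -> W := plift (va_to_W (fun=> 1)).
(** Unlike [projK], it sees the sigma letters, and so reads the reflection off a root. *)
Definition projP : V -> W := plift (va_to_W wgen).
Definition iota : W -> V := plift (vgen \o @tau S).

Lemma respects_K : respects (va_rel m) (va_to_W (fun=> 1)).
Proof.
apply: respects_va => [|u v _|s t k _ _]; first exact: respects_pgen.
- by rewrite /peval !big1.
- by rewrite mulg1 mul1g.
Qed.

Lemma respects_P : respects (va_rel m) (va_to_W wgen).
Proof.
apply: respects_va => [||s t k st mst]; first exact: respects_pgen.
  by move=> u v uv; apply: respects_pgen; right.
have k2 : (2 <= k)%N by case: hm => _ _ /(_ s t k st mst).
have kk : k.-1.+1 = k by rewrite prednK // ltnW.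
rewrite -[LHS]/(peval wgen (alt s t k.-1) * wgen s) -peval_rcons.
rewrite -[RHS]/(wgen _ * peval wgen (alt s t k.-1)) -peval_cons.
have z := gen_zig st mst; rewrite -{}kk in z *; move: k.-1 z => n z.
rewrite -[rcons _ _]/(alt t s n.+1) !alt_zig /=.
by case: (odd n); rewrite /= -/(zig _ _ n.+1) ?z // -z.
Qed.

Lemma respects_iota : respects (coxeter_rel m) (vgen \o @tau S).
Proof.
move=> u v uv; rewrite -!(peval_map (@tau S) vgen); apply: respects_pgen; case: uv.
  by move=> [s [-> ->]]; right; right; left; exists s.
by move=> [s [t [k [st [mst [-> ->]]]]]]; rewrite !map_alt; right; left; exists s, t, k.
Qed.

Lemma iotaM : {morph iota : x y / x * y}. Proof. exact: pliftM respects_iota. Qed.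
Lemma iota1 : iota 1 = 1. Proof. exact: plift1 respects_iota. Qed.
Lemma iotaV : {morph iota : x / x^-1}. Proof. exact: pliftV respects_iota. Qed.
Lemma iota_gen s : iota (wgen s) = vgen (tau s). Proof. exact: plift_gen respects_iota s. Qed.

Lemma iota_word u : iota (weval wgen u) = weval vgen (iota_W u).
Proof. by rewrite /iota (plift_weval respects_iota) /weval big_map. Qed.

Lemma proj_iota f w : respects (va_rel m) (va_to_W f) -> plift (va_to_W f) (iota w) = w.
Proof.
move=> fR; rewrite -[in LHS](weval_prepr w) iota_word (plift_weval fR) /weval big_map.
exact: weval_prepr.
Qed.

(* A generator of A is an element [w sigma_s w^-1] of VA together with the root
   [w alpha_s], viewed as a functional on the dual representation: the latter
   separates a root from its opposite. Pairs not of this form are harmless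
   extra free generators. *)
Definition root : Type := (V * ((S -> algC) -> algC))%type.
Definition simple s : root := (vgen (sigma s), fun f => f s).
Definition root_act (w : W) (p : root) : root :=
  (p.1 ^ (iota w)^-1, fun f => p.2 (dual_act f w)).

Lemma root_actM v w p : root_act (v * w) p = root_act v (root_act w p).
Proof.
congr (_, _); first by rewrite iotaM invgM conjgM.
by apply/funext => f; rewrite dual_actM.
Qed.

Lemma root_act1 p : root_act 1 p = p.
Proof.
case: p => x F; rewrite /root_act iota1 invg1 conjg1; congr (_, _).
by apply/funext => f; rewrite dual_act1.
Qed.

Lemma root_actK w p : root_act w^-1 (root_act w p) = p.
Proof. by rewrite -root_actM mulVg root_act1. Qed.

Lemma root_act_inj w : injective (root_act w).
Proof. exact: can_inj (root_actK w). Qed.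

Lemma simple_mixed s t k : s <> t -> m s t = Some k ->
  root_act (peval wgen (alt s t k.-1)) (simple s) = simple (if odd k then t else s).
Proof.
move=> st mst; congr (_, _); last first.
  by apply/funext => f; exact: (dual_act_alt hm f st mst).
have -> : iota (peval wgen (alt s t k.-1)) = peval (vgen \o @tau S) (alt s t k.-1).
  by rewrite -weval_pos /iota (plift_weval respects_iota) weval_pos.
by rewrite /= conjgE invgK mulgA (va_mixed st mst) mulgK.
Qed.

Lemma projP_root w s : projP (root_act w (simple s)).1 = w * wgen s * w^-1.
Proof.
rewrite /projP /= conjgE invgK !(pliftM respects_P) (pliftV respects_P).
by rewrite (plift_gen respects_P) (proj_iota _ respects_P) mulgA.
Qed.

Definition edge (p q : root) k := exists w s t,
  [/\ s <> t, m s t = Some k, p = root_act w (simple s) & q = root_act w (simple t)].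

Lemma edge_neq p q k : edge p q k -> p <> q.
Proof.
move=> [w [s [t [st _ -> ->]]]] /(congr1 (projP \o fst)) /=; rewrite !projP_root.
by move=> /mulIg/mulgI/(gen_inj hm).
Qed.

(** Equal roots have equal reflections, so [w'^-1 * w] conjugates one pair of generators to the
    other and [gen_conj_label] compares the labels. *)
Lemma edge_fun p q k k' : edge p q k -> edge p q k' -> k = k'.
Proof.
move=> [w [s [t [st mst -> ->]]]] [w' [s' [t' [st' mst' ep eq]]]].
have e1 := congr1 (projP \o fst) ep; have e2 := congr1 (projP \o fst) eq.
rewrite /= !projP_root in e1 e2.
have := @gen_conj_label _ _ hm (w'^-1 * w) s t s' t' k st mst.
have eg r r' : w * wgen r * w^-1 = w' * wgen r' * w'^-1 ->
    w'^-1 * w * wgen r = wgen r' * (w'^-1 * w).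
  by move=> e; rewrite -!mulgA; apply: (mulgI w'); rewrite mulVKg !mulgA -e mulgVK.
by case/(_ (eg _ _ e1) (eg _ _ e2)); rewrite mst' => _ [].
Qed.

Lemma edge_sym p q k : edge p q k -> edge q p k.
Proof.
move=> [w [s [t [st mst -> ->]]]]; exists w, t, s; split=> //; first by move/esym.
by case: hm => _ <-.
Qed.

Lemma edge_act w p q k : edge p q k -> edge (root_act w p) (root_act w q) k.
Proof. by move=> [v [s [t [st mst -> ->]]]]; exists (w * v), s, t; rewrite !root_actM. Qed.

Definition root_matrix (p q : root) : option nat :=
  if pselect (p = q) then Some 1%N
  else if pselect (exists k, edge p q k) is left ex then Some (sval (cid ex)) else None.

Lemma root_matrixP p q k :
  root_matrix p q = Some k <-> (p = q /\ k = 1%N) \/ edge p q k.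
Proof.
rewrite /root_matrix; case: pselect => [pq|pq].
  by split=> [[<-]|[[_ ->]|/edge_neq]] //; left.
case: pselect => [ex|nex]; last by split=> // -[[]|pqk] //; case: nex; exists k.
case: cid => j /= pqj; split=> [[<-]|[[]|pqk]] //; first by right.
by congr Some; exact: edge_fun pqj pqk.
Qed.

Lemma root_matrix_eq p q p' q' :
  (p = q <-> p' = q') -> (forall k, edge p q k <-> edge p' q' k) ->
  root_matrix p q = root_matrix p' q'.
Proof.
move=> pq ed; case e: (root_matrix p' q') => [k|].
  by apply/root_matrixP; move/root_matrixP: e => [[/pq]|/ed]; [left|right].
case e': (root_matrix p q) => [k|//]; rewrite -e; apply/esym/root_matrixP.
by move/root_matrixP: e' => [[/pq]|/ed]; [left|right].
Qed.

Lemma root_matrix_sym p q : root_matrix p q = root_matrix q p.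
Proof. by apply: root_matrix_eq => [|k]; split=> // /edge_sym. Qed.

Lemma root_matrix_act w p q :
  root_matrix (root_act w p) (root_act w q) = root_matrix p q.
Proof.
apply: root_matrix_eq => [|k]; first by split=> [/root_act_inj|->].
by split=> [/(edge_act w^-1)|/edge_act //]; rewrite !root_actK.
Qed.

Lemma root_coxeter_matrix : coxeter_matrix root_matrix.
Proof.
split=> [p|p q|p q k pq /root_matrixP[[]|] //]; first by apply/root_matrixP; left.
  exact: root_matrix_sym.
by move=> [w [s [t [st mst _ _]]]]; case: hm => _ _ /(_ s t k st mst).
Qed.

Notation A := (pgroup (artin_rel root_matrix)).
Notation agen := (pgen (artin_rel root_matrix)).

(* The action of VA on A x W by right multiplication in the semidirect product. *)
Definition va_act (x : W * A) (l : va_letter S * bool) : W * A :=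
  match l.1 with
  | sigma s => let d := agen (root_act x.1 (simple s)) in
               (x.1, x.2 * if l.2 then d^-1 else d)
  | tau s => (x.1 * wgen s, x.2)
  end.

(** The part in A of a word read from the state [w]; the flag of a tau letter is dropped because tau
    is an involution in VA. *)
Fixpoint root_word (w : W) (u : seq (va_letter S * bool)) : seq (root * bool) :=
  match u with
  | [::] => [::]
  | (sigma s, e) :: u => (root_act w (simple s), e) :: root_word w u
  | (tau s, _) :: u => root_word (w * wgen s) u
  end.

Lemma va_act_word x u : foldl va_act x u =
  (x.1 * weval (va_to_W (fun=> 1)) u, x.2 * weval agen (root_word x.1 u)).
Proof.
elim: u x => [|[[s|s] e] u IH] [w a] /=; rewrite ?weval_nil ?mulg1 // IH /va_act /= weval_cons /=.
  by rewrite [X in _ = (w * (X * _), _)](_ : _ = 1) ?mul1g ?weval_cons ?mulgA //; case: e; rewrite ?invg1.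
by case: e; rewrite /= ?gen_inv mulgA.
Qed.

Notation vstep := (fun x l => va_act x (l, false)).

Lemma va_act_sigma x u : foldl vstep x [seq sigma s | s <- u] =
  (x.1, x.2 * peval (fun s => agen (root_act x.1 (simple s))) u).
Proof.
elim: u x => [|s u IH] [w a] /=; first by rewrite peval_nil mulg1.
by rewrite IH peval_cons mulgA.
Qed.

Lemma va_act_tau x u : foldl vstep x [seq tau s | s <- u] = (x.1 * peval wgen u, x.2).
Proof.
elim: u x => [|s u IH] [w a] /=; first by rewrite peval_nil mulg1.
by rewrite IH peval_cons mulgA.
Qed.

Lemma va_act_pres_eq x u v : pres_eq (va_rel m) u v -> foldl va_act x u = foldl va_act x v.
Proof.
move=> uv; apply: (foldl_pres_eq (I := fun=> True)) uv x _ => //.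
  move=> [w a] [s|s] e _; rewrite /va_act /=; last by rewrite -mulgA gen_sq mulg1.
  by case: e; rewrite /= ?mulgK ?mulgVK.
move=> {u v} u v [w a] + _ => -[|[|[|]]].
- move=> [s [t [k [st [mst [-> ->]]]]]]; rewrite -!map_alt !va_act_sigma /=.
  congr (_, _ * _); apply: zig_rel.
  rewrite !(peval_map_zig (fun r => root_act w (simple r)) agen).
  have ed : edge (root_act w (simple s)) (root_act w (simple t)) k by exists w, s, t.
  by apply: agen_zig (edge_neq ed) _; apply/root_matrixP; right.
- move=> [s [t [k [st [mst [-> ->]]]]]]; rewrite -!map_alt !va_act_tau /=.
  by congr (_ * _, _); apply: respects_pgen; right; exists s, t, k.
- by move=> [s [-> ->]]; rewrite /= /va_act /= -mulgA gen_sq mulg1.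
- move=> [s [t [k [st [mst [-> ->]]]]]]; rewrite -!map_alt foldl_cat.
  rewrite /= [in RHS]/va_act /= !va_act_tau /va_act /= root_actM.
  by rewrite (simple_mixed st mst).
Qed.

Lemma root_word_act v w u :
  root_word (v * w) u = [seq (root_act v l.1, l.2) | l <- root_word w u].
Proof. by elim: u w => [//|[[s|s] e] u IH] w /=; rewrite ?root_actM -?mulgA IH. Qed.

Definition simple_root p := exists w s, p = root_act w (simple s).

Lemma respects_fst : respects (artin_rel root_matrix) (fst : root -> V).
Proof.
apply: respects_artin => p q k pq /root_matrixP[[]|] //.
move=> [w [s [t [st mst -> ->]]]]; rewrite -!peval_map_zig.
have conj u : peval (fst \o (fun s => root_act w (simple s))) u =
    peval (vgen \o @sigma S) u ^ (iota w)^-1 by exact: peval_conj.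
by rewrite !conj; congr (_ ^ _); apply: alt_rel; exact: va_sigma.
Qed.

(** The way back to VA: an element is its part in A, mapped by [fst], times its part in W.
    Triviality in A thus transfers to VA. *)
Lemma root_word_fst w u :
  weval fst (root_word w u) * iota (w * weval (va_to_W (fun=> 1)) u) =
  iota w * weval vgen u.
Proof.
elim: u w => [|[[s|s] e] u IH] w /=; first by rewrite !weval_nil mulg1 mul1g mulg1.
  rewrite !weval_cons /= [X in iota (w * (X * _))](_ : _ = 1) ?mul1g; last first.
    by case: e; rewrite ?invg1.
  rewrite -mulgA IH !mulgA; congr (_ * _).
  by case: e; rewrite /= -?conjVg conjgE invgK -!mulgA mulVg mulg1.
rewrite !weval_cons /= mulgA; have -> : (if e then (wgen s)^-1 else wgen s) = wgen s.
  by case: e; rewrite ?gen_inv.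
rewrite IH iotaM iota_gen mulgA; congr (_ * _ * _).
by case: e => //; rewrite -iota_gen -iotaV gen_inv.
Qed.

Lemma simple_root_crossing p : simple_root p ->
  exists theta : root -> root, [/\ involutive theta,
    forall q r, root_matrix (theta q) (theta r) = root_matrix q r,
    theta p <> p, root_matrix p (theta p) = None & exists w, theta = root_act w].
Proof.
move=> [w [s ->]]; set r := w * wgen s * w^-1.
have rr : r * r = 1 by rewrite /r -!mulgA mulKg [wgen s * (_ * _)]mulgA gen_sq mul1g mulgV.
have rw : r * w = w * wgen s by rewrite /r mulgVK.
have neq : root_act r (root_act w (simple s)) <> root_act w (simple s).
  (* The constant function 1, moved by [w^-1], takes the value 1 on the root and -1 on its
     opposite. *)
  rewrite -root_actM rw => /(congr1 (fun q : root => q.2 (dual_act (m := m) (fun=> 1%R) w^-1))).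
  rewrite /= -!(dual_actM hm) mulKg mulVg (dual_act1 hm) (dual_act_gen hm) refl_act_diag.
  by move/eqP; rewrite eq_sym -GRing.subr_eq0 GRing.opprK -(GRing.natrD _ 1 1) Num.Theory.pnatr_eq0.
exists (root_act r); split=> //; last by exists r.
- by move=> q; rewrite -root_actM rr root_act1.
- exact: root_matrix_act.
case e: root_matrix => [k|//]; move/root_matrixP: e => [[e _]|].
  by case: neq.
rewrite -root_actM rw => -[v [a [b [ab _ e1 e2]]]].
have := congr1 (projP \o fst) e1; have := congr1 (projP \o fst) e2.
rewrite /= !projP_root invgM mulgA mulgK => -> /mulIg/mulgI/(gen_inj hm) ba.
by case: ab.
Qed.

(* Each letter of a word is removed in turn: the element lies in the subgroup
   avoiding it, by splitting along the root and its opposite. *)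
Lemma root_fixed_trivial u : (forall l, List.In l u -> simple_root l.1) ->
  (forall w, weval agen [seq (root_act w l.1, l.2) | l <- u] = weval agen u) ->
  weval agen u = 1.
Proof.
move=> simple_u fix_u.
pose among (r : seq root) : pred root := fun p => `[< List.In p r >].
suff: forall r, (forall p, List.In p r -> simple_root p) ->
    gspan (among r) (weval agen u) -> weval agen u = 1.
  move=> /(_ [seq l.1 | l <- u]); apply.
    by move=> p /List.in_map_iff[l [<- /simple_u]].
  exists u => //; apply: (@sub_all _ (fun l => `[< List.In l u >])).
    by move=> l /asboolP lu; apply/asboolP; exact: (List.in_map fst).
  elim: (u) => //= l v IH; apply/andP; split; first by apply/asboolP; left.
  by apply: sub_all IH => k /asboolP kv; apply/asboolP; right.
elim=> [_ [[|l v] /=]|p r IH simple_r span_r].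
- by rewrite weval_nil.
- by move/andP=> [/asboolP].
apply: IH => [q qr|]; first by apply: simple_r; right.
have [theta [thetaK theta_m np mp [w ew]]] := simple_root_crossing (simple_r p (or_introl erefl)).
have pnp : p <> theta p by move/esym.
have fixp : gspan (avoid p (theta p)) (weval agen u).
  by apply: (artin_fixed_avoid root_matrix_sym pnp mp thetaK theta_m) => //; rewrite ew.
have [v rv <-] := artin_gspanI root_coxeter_matrix span_r fixp.
exists v => //; apply: sub_all rv => l /andP[/asboolP[lp|lr] /asboolP[nlp _]].
  by case: nlp.
exact/asboolP.
Qed.

(** Reading [w] before [u] instead of after it acts by [w] on the part in A; commutation therefore
    says that this part is fixed by W. *)
Lemma va_centralizer_kernel u : weval (va_to_W (fun=> 1)) u = 1 ->
  (forall w, weval vgen u * iota w = iota w * weval vgen u) -> weval vgen u = 1.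
Proof.
move=> u1 comu.
have fixu w : weval agen [seq (root_act w l.1, l.2) | l <- root_word 1 u] =
    weval agen (root_word 1 u).
  have [t <-] : exists t, weval wgen t = w by exists (prepr w); exact: weval_prepr.
  set tw := iota_W t.
  have actt a : foldl va_act (1, a) tw = (weval wgen t, a).
    rewrite va_act_word mul1g; congr (_, _).
      by rewrite /weval big_map.
    rewrite -[RHS]mulg1; congr (_ * _).
    by rewrite /tw; elim: (t) 1 => [|[s e] v IH] w1 /=; rewrite ?weval_nil // IH.
  have /weval_eqP/(va_act_pres_eq (1, 1)) : weval vgen (tw ++ u) = weval vgen (u ++ tw).
    by rewrite !weval_cat -iota_word comu.
  rewrite !foldl_cat actt !va_act_word u1 /= => /(congr1 snd) /=; rewrite !mul1g.
  have -> : root_word 1 tw = [::] by rewrite /tw; elim: (t) (1 : W) => /=.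
  by rewrite weval_nil mulg1 -[X in root_word X u]mulg1 root_word_act.
have simple_u l : List.In l (root_word 1 u) -> simple_root l.1.
  elim: (u) (1) => [//|[[s|s] e] v IH] w /=; last exact: IH.
  by case=> [<-|/IH //]; exists w, s.
have := root_word_fst 1 u; rewrite u1 mulg1 iota1 mulg1 mul1g => <-.
rewrite -(plift_weval respects_fst) root_fixed_trivial //.
exact: plift1 respects_fst.
Qed.

End VirtualArtin.

(* g lies in the centralizer of iota_W(W) in VA  <->  g = iota_W(z) for some
   z in the center Z(W). *)
Theorem theorem3p3 (S : countType) (m : S -> S -> option nat)
    (hm : is_coxeter_matrix m) (g : seq (va_letter S * bool)) :
  (forall w : seq (S * bool), VA_eq m (g ++ iota_W w) (iota_W w ++ g)) <->
  (exists z : seq (S * bool),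
     (forall w : seq (S * bool), W_eq m (z ++ w) (w ++ z)) /\
     VA_eq m g (iota_W z)).
Proof.
have cm : coxeter_matrix m by case: hm => m1 [msym m2]; split.
pose vgen := pgen (va_rel m); pose wgen := pgen (coxeter_rel m).
have RK := @respects_K S m.
split=> [comg|[z [comz gz]] w]; last first.
  apply/weval_eqP; have /weval_eqP ez := gz; rewrite !weval_cat ez -!(iota_word m) -!iotaM.
  by have /weval_eqP := comz w; rewrite !weval_cat => ->.
have comG w : weval vgen g * iota (m := m) w = iota w * weval vgen g.
  rewrite -[w]weval_prepr iota_word -!weval_cat; apply/weval_eqP; exact: comg.
(* The part of [g] in W. It is central because [projK] is a left inverse of [iota] and [g] commutes
   with the image of [iota]. *)
set Z := weval (va_to_W (fun=> 1 : pgroup (coxeter_rel m))) g.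
have ZE : Z = projK (weval vgen g) by rewrite /projK plift_weval.
exists (prepr Z); split.
  move=> w; apply/weval_eqP; rewrite !weval_cat weval_prepr ZE.
  have := congr1 (@projK S m) (comG (weval wgen w)).
  by rewrite /projK !(pliftM RK) !(proj_iota _ RK).
have iZ : weval vgen (iota_W (prepr Z)) = iota Z by rewrite -iota_word weval_prepr.
apply/weval_eqP; rewrite iZ; apply: divg1_eq; rewrite -iZ -weval_wordV -weval_cat.
apply: (va_centralizer_kernel cm).
  rewrite weval_cat weval_wordV -/Z -(plift_weval RK) iZ.
  by rewrite (proj_iota _ RK) mulgV.
move=> w; rewrite weval_cat weval_wordV iZ.
have comZ : Z * w = w * Z.
  by have := congr1 (@projK S m) (comG w); rewrite /projK !(pliftM RK) !(proj_iota _ RK) -/(projK _) -ZE.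
rewrite -mulgA -iotaV -iotaM.
have -> : Z^-1 * w = w * Z^-1.
  by apply: (mulgI Z); rewrite mulVKg mulgA comZ mulgK.
by rewrite iotaM mulgA comG !mulgA.
Qed.
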